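(* Let $Q$ be a quiver and let $\boldsymbol\alpha\le\boldsymbol n$ be dimension vectors for $Q$. Then $\boldsymbol\alpha\le_Q\boldsymbol n$ if and only if both of the following hold: (A) $\langle\boldsymbol\alpha,\boldsymbol n-\boldsymbol\alpha\rangle\ge 0$; (B) $\boldsymbol\beta<_Q\boldsymbol n$ for every $\boldsymbol\beta<_Q\boldsymbol\alpha$.
   Context: A quiver $Q=(Q_0,Q_1)$ has a finite vertex set $Q_0$ and a finite arrow set $Q_1$ (cycles and multiple arrows allowed); $a\colon x\to y$ denotes an arrow. A dimension vector is a family $\boldsymbol n=(n_x)_{x\in Q_0}$ of nonnegative integers; $\boldsymbol\alpha\le\boldsymbol n$ means $\alpha_x\le n_x$ for all $x$. The Euler form is $$\langle\boldsymbol\alpha,\boldsymbol\beta\rangle=\sum_{x\in Q_0}\alpha_x\beta_x-\sum_{a\colon x\to y\in Q_1}\alpha_x\beta_y .$$ Let $\mathcal V=(V_x)_{x\in Q_0}$ be a family of finite-dimensional complex vector spaces with $\dim V_x=n_x$. A representation of $Q$ on $\mathcal V$ is $v=(v_a)\in\bigoplus_{a\colon x\to y}\mathrm{Hom}(V_x,V_y)$; a subrepresentation of $v$ is a family of subspaces $S_x\subseteq V_x$ with $v_aS_x\subseteq S_y$ for every arrow $a\colon x\to y$. We write $\boldsymbol\alpha\le_Q\boldsymbol n$ ($\boldsymbol\alpha$ is a Schofield subdimension vector) if $\boldsymbol\alpha\le\boldsymbol n$ and every representation $v$ of $Q$ on $\mathcal V$ has a subrepresentation $\mathcal S=(S_x)$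 with $\dim S_x=\alpha_x$ for all $x$; this depends only on $\boldsymbol\alpha,\boldsymbol n$. We write $\boldsymbol\alpha<_Q\boldsymbol n$ if in addition $\alpha_x<n_x$ for at least one $x$. *)

(* Defs.v *)
From HB Require Import structures.
From mathcomp Require Import all_boot all_order all_algebra.
From mathcomp Require Import complex reals.

Set Implicit Arguments.
Unset Strict Implicit.
Unset Printing Implicit Defensive.

Import Order.TTheory GRing.Theory Num.Theory.
Local Open Scope ring_scope.

Record quiver := Quiver {
  vertex : finType;
  arrow : finType;
  source : arrow -> vertex;
  target : arrow -> vertex
}.

Definition dimvec (Q : quiver) := vertex Q -> nat.

Definition dimvec_le (Q : quiver) (alpha n : dimvec Q) : Prop :=
  forall x, (alpha x <= n x)%N.

(* Integer-valued arguments, so that n - alpha is a genuine difference. *)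
Definition euler_form (Q : quiver) (alpha beta : vertex Q -> int) : int :=
  \sum_(x : vertex Q) alpha x * beta x
  - \sum_(a : arrow Q) alpha (source a) * beta (target a).

Definition representation (F : fieldType) (Q : quiver)
    (V : vertex Q -> vectType F) :=
  forall a : arrow Q, 'Hom(V (source a), V (target a)).

Definition subrepresentation (F : fieldType) (Q : quiver)
    (V : vertex Q -> vectType F) (v : representation V)
    (S : forall x, {vspace V x}) : Prop :=
  forall a : arrow Q, (v a @: S (source a) <= S (target a))%VS.

(* The condition does not depend on the choice of spaces V x of dimension n x;
   it is required of all of them rather than of the coordinate spaces only. *)
Definition schofield_le (F : fieldType) (Q : quiver)
    (alpha n : dimvec Q) : Prop :=
  dimvec_le alpha n /\
  forall V : vertex Q -> vectType F, (forall x, \dim {:V x} = n x) ->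
  forall v : representation V,
  exists S : forall x, {vspace V x},
    subrepresentation v S /\ forall x, \dim (S x) = alpha x.

Definition schofield_lt (F : fieldType) (Q : quiver)
    (alpha n : dimvec Q) : Prop :=
  schofield_le F alpha n /\ exists x, (alpha x < n x)%N.

(* Main.v *)
Require Import Defs.
From HB Require Import structures.
From mathcomp Require Import all_boot all_order all_algebra.
From mathcomp Require Import complex reals.
From mathcomp Require Import boolp classical_sets cardinality.
From mathcomp Require Import ring lra zify.

Set Implicit Arguments.
Unset Strict Implicit.
Unset Printing Implicit Defensive.

Import Order.TTheory GRing.Theory Num.Theory.
Local Open Scope ring_scope.

(* Write [W(alpha)] for the set of Schofield subdimension vectors of [alpha].

   Necessity of (A): the representations having a subrepresentation of dimension [alpha]
   are covered by finitely many polynomial charts in [dim Rep(n) + <alpha, n - alpha>]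
   parameters. (B) is transitivity.

   Sufficiency. Put [gamma = n - alpha]. By specialization along places, a sufficiently
   transcendental representation of dimension [alpha] has subrepresentations exactly in
   the dimensions [W(alpha)]. Let [beta] in [W(alpha)] minimize [<beta, gamma>], and be of
   least size among the minimizers. The corresponding subrepresentation has no nonzero
   morphism to the quotient, so [<beta, alpha - beta> <= 0], and (A) or (B) gives
   [<beta, gamma> >= <beta, n - beta> >= 0]. Thus [<beta, gamma> >= 0] on [W(alpha)], and
   this implies, by induction on [alpha], that [Ext(v, w) = 0] for some [v], [w] of
   dimensions [alpha], [gamma]. Then the subrepresentation [v] of [v + w] lifts to formal
   power series along the line from [v + w] to any representation [u] of dimension [n],
   and a place of the field of Laurent series specializes it to a subrepresentation of
   [u]. *)

(** * Places *)

(** Two geometric facts govern the proof, and both are replaced by algebra. Closedness of the set of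
    representations with a subrepresentation of given dimension, usually drawn from properness of
    Grassmannians, becomes the valuative statement that subrepresentations survive a place; it
    serves once to pass from a transcendental point of a line to a special one, and once to leave
    the formal neighbourhood of a direct sum. Openness becomes persistence along every line off a
    countable set of parameters, and such conditions meet because the field is uncountable.
    Vanishing of Ext is a full rank condition on one matrix, linear in the pair of representations;
    maximality of its rank at a generic pair yields the first-order information that the induction
    on [al] needs. *)

Section Places.
Variables (K : fieldType) (L : closedFieldType).
Implicit Types (G H : set (K * L)) (x : K) (w : L).

Lemma mul_pair (a c : K) (b d : L) : (a, b) * (c, d) = (a * c, b * d).
Proof. by []. Qed.

(* The graph of a ring morphism to [L] defined on some subring of [K]. *)
Definition ring_graph G :=
  [/\ G 1, forall z z', G z -> G z' -> G (z - z'),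
      forall z z', G z -> G z' -> G (z * z') & forall y, G (0, y) -> y = 0].

Definition max_ring_graph G :=
  ring_graph G /\ forall H, ring_graph H -> (G `<=` H)%classic -> (H `<=` G)%classic.

(** Zorn's lemma is applied to the sets whose union with [G0] is a ring graph, so that the empty
    chain qualifies too. Each axiom involves at most two elements, which a chain places in a common
    member. *)
Lemma ring_graph_extends G0 :
  ring_graph G0 -> exists G, (G0 `<=` G)%classic /\ max_ring_graph G.
Proof.
move=> G0P; pose P H := ring_graph (G0 `|` H)%classic.
have [F FP Ftot|A [PA maxA]] := @Zorn_bigcup _ P; last first.
  exists (G0 `|` A)%classic; split; first by move=> z; left.
  split=> // H HP GH; have HE : (G0 `|` H)%classic = H.
    by rewrite setUidr // => z zG; apply: GH; left.
  apply: contrapT => nHG; apply: (maxA H); last by rewrite /P HE.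
  split; last by move=> HA; apply: nHG => z /HA; right.
  by move=> z zA; apply: GH; right.
have dir z z' : (G0 `|` \bigcup_(X in F) X)%classic z ->
    (G0 `|` \bigcup_(X in F) X)%classic z' ->
    exists H, [/\ ring_graph H, H z, H z'
      & (H `<=` G0 `|` \bigcup_(X in F) X)%classic].
  case=> [z0|[X FX Xz]] [z'0|[Y FY Yz]].
  - by exists G0; split=> // u; left.
  - exists (G0 `|` Y)%classic; split; [exact: FP|by left|by right|].
    by move=> u [|?]; [left|right; exists Y].
  - exists (G0 `|` X)%classic; split; [exact: FP|by right|by left|].
    by move=> u [|?]; [left|right; exists X].
  - have [XY|YX] := Ftot _ _ FX FY.
      exists (G0 `|` Y)%classic; split; [exact: FP|by right; apply: XY|by right|].
      by move=> u [|?]; [left|right; exists Y].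
    exists (G0 `|` X)%classic; split; [exact: FP|by right|by right; apply: YX|].
    by move=> u [|?]; [left|right; exists X].
split.
- by left; case: G0P.
- by move=> z z' /dir/[apply] -[H [[_ HB _ _] Hz Hz' sH]]; apply/sH/HB.
- by move=> z z' /dir/[apply] -[H [[_ _ HM _] Hz Hz' sH]]; apply/sH/HM.
- by move=> y Hy; have [H [[_ _ _ H0] Hz _ _]] := dir _ _ Hy Hy; apply: H0.
Qed.

Section RingGraph.
Variable G : set (K * L).
Hypothesis GP : ring_graph G.

Lemma ring_graph0 : G 0.
Proof. by case: GP => G1 GB _ _; rewrite -(subrr 1); apply: GB. Qed.

Lemma ring_graphN z : G z -> G (- z).
Proof. by case: (GP) => _ GB _ _ ?; rewrite -sub0r; apply: GB => //; exact: ring_graph0. Qed.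

Lemma ring_graphD z z' : G z -> G z' -> G (z + z').
Proof.
case: (GP) => _ GB _ _ zG z'G; rewrite -[z']opprK; apply: GB => //.
exact: ring_graphN.
Qed.

Lemma ring_graph_pairB a b c d : G (a, b) -> G (c, d) -> G (a - c, b - d).
Proof. by case: (GP) => _ GB _ _; exact: GB. Qed.

Lemma ring_graph_pairB0 a c d : G (a, d) -> G (c, 0) -> G (a - c, d).
Proof. by move=> aG cG; rewrite -[d]subr0; apply: ring_graph_pairB. Qed.

Lemma ring_graph_pairM0 a c d : G (a, d) -> G (c, 0) -> G (a * c, 0).
Proof.
by case: (GP) => _ _ GM _ aG cG; rewrite -(mulr0 d) -mul_pair; apply: GM.
Qed.

Lemma ring_graph_sum (I : Type) (r : seq I) (P : pred I) (F : I -> K * L) :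
  (forall i, P i -> G (F i)) -> G (\sum_(i <- r | P i) F i).
Proof. by move=> FG; elim/big_ind: _ => //; [exact: ring_graph0|exact: ring_graphD]. Qed.

Lemma ring_graphX z n : G z -> G (z ^+ n).
Proof.
case: GP => G1 _ GM _ zG.
by elim: n => [|n IH]; rewrite ?expr0 // exprS; apply: GM.
Qed.

(** The set is the subring of [K * L] generated by [G] and [z]; the hypothesis says exactly that it
    is still single-valued. *)
Lemma ring_graph_adjoin z :
  (forall P : {poly K * L}, (forall i, G P`_i) -> P.[z].1 = 0 -> P.[z].2 = 0) ->
  ring_graph [set P.[z] | P in [set P : {poly K * L} | forall i, G P`_i]]%classic.
Proof.
case: (GP) => G1 GB GM _ zP; split.
- exists 1; last by rewrite hornerE.
  by move=> i; rewrite coef1; case: eqP => _ //=; exact: ring_graph0.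
- move=> _ _ [P GPP <-] [Q GQ <-]; exists (P - Q); last by rewrite !hornerE.
  by move=> i; rewrite coefB; apply: GB.
- move=> _ _ [P GPP <-] [Q GQ <-]; exists (P * Q); last by rewrite hornerM.
  by move=> i; rewrite coefM; apply: ring_graph_sum => j _; apply: GM.
- by move=> y [P GPP PE]; have := zP P GPP; rewrite PE; apply.
Qed.

End RingGraph.

Section MaxRingGraph.
Variable G : set (K * L).
Hypothesis Gmax : max_ring_graph G.
Let GP : ring_graph G := proj1 Gmax.

Lemma max_ring_graphP z : ~ G z ->
  exists P : {poly K * L}, [/\ forall i, G P`_i, P.[z].1 = 0 & P.[z].2 <> 0].
Proof.
move=> nGz; apply: contrapT => nP; apply: nGz.
pose H := [set P.[z] | P in [set P : {poly K * L} | forall i, G P`_i]]%classic.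
suff HG : (H `<=` G)%classic.
  apply: HG; exists 'X; last by rewrite hornerX.
  move=> i; rewrite coefX; case: eqP => _; first by case: GP.
  exact: ring_graph0.
apply: (proj2 Gmax).
  apply: ring_graph_adjoin => // P PG P1; apply: contrapT => P2.
  by apply: nP; exists P.
move=> u uG; exists u%:P; last by rewrite hornerC.
by move=> i; rewrite coefC; case: eqP => _ //; exact: ring_graph0.
Qed.

(** The domain is a local ring. An obstruction [P] to adjoining the inverse, multiplied by a power
    of [(x, y)] that clears denominators, would be an element of [G] over 0 with nonzero value. *)
Lemma max_ring_graphV x y : G (x, y) -> y != 0 -> G (x^-1, y^-1).
Proof.
move=> xyG y0; have x0 : x != 0.
  by apply: contra_neq y0 => x0; case: GP => _ _ _; apply; rewrite -x0.
apply: contrapT => /max_ring_graphP [P [PG P1 P2]]; apply: P2.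
pose d := (size P).-1.
have : G ((x, y) ^+ d * P.[(x^-1, y^-1)]).
  case: (GP) => G1 _ GM _.
  rewrite horner_coef mulr_sumr; apply: ring_graph_sum => // i _.
  rewrite mulrCA; apply: (GM) => //.
  have -> : (x, y) ^+ d * (x^-1, y^-1) ^+ i = (x, y) ^+ (d - i).
    have id : (i <= d)%N by rewrite /d -ltnS (leq_trans (ltn_ord i)) // leqSpred.
    rewrite -{1}(subnK id) exprD -mulrA -exprMn.
    suff -> : (x, y) * (x^-1, y^-1) = 1 by rewrite expr1n mulr1.
    by rewrite mul_pair !divff.
  exact: ring_graphX.
have -> : (x, y) ^+ d * P.[(x^-1, y^-1)] = (0, y ^+ d * P.[(x^-1, y^-1)].2).
  have -> : (x, y) ^+ d = (x ^+ d, y ^+ d).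
    by elim: (d) => [|n IH]; rewrite ?expr0 // !exprS IH mul_pair.
  by rewrite {1}[P.[_]]surjective_pairing P1 mul_pair mulr0.
move=> G0; case: GP => _ _ _ /(_ _ G0) /eqP.
by rewrite mulf_eq0 expf_eq0 (negPf y0) andbF => /eqP.
Qed.

Let over (p : {poly K}) (q : {poly L}) := forall i, G (p`_i, q`_i).

Let over_map (P : {poly K * L}) : (forall i, G P`_i) -> over (map_poly fst P) (map_poly snd P).
Proof. by move=> PG i; rewrite !coef_map -surjective_pairing. Qed.

(* If no value can be given to [x], the polynomials killing [x] have no common zero once
   mapped to [L]; one of minimal degree among their images is then a constant. *)
Lemma max_ring_graph_relation x : (forall w, ~ G (x, w)) ->
  exists p : {poly K}, [/\ p.[x] = 0, p`_0 = 1 & forall i, (0 < i)%N -> G (p`_i, 0)].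
Proof.
move=> nGx; pose J q := exists2 p, over p q & p.[x] = 0.
have JP w : exists2 q, J q & q.[w] != 0.
  have [P [PG P1 /eqP P2]] := max_ring_graphP (nGx w).
  have Ep : (map_poly fst P).[x] = P.[(x, w)].1.
    by rewrite -(horner_map fst).
  have Eq : (map_poly snd P).[w] = P.[(x, w)].2.
    by rewrite -(horner_map snd).
  exists (map_poly snd P); last by rewrite Eq.
  by exists (map_poly fst P); [exact: over_map|rewrite Ep].
have Jmin (Q : {poly L} -> Prop) : (exists2 q, J q & Q q) ->
    exists q, [/\ J q, Q q & forall q', J q' -> Q q' -> (size q <= size q')%N].
  case=> q0 Jq0 Qq0; have [|n /asboolP[q [Jq Qq sq] nmin]] :=
    @ex_minnP (fun n => `[< exists q, [/\ J q, Q q & size q = n] >]).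
    by exists (size q0); apply/asboolP; exists q0.
  exists q; split=> // q' Jq' Qq'; rewrite sq; apply: nmin; apply/asboolP.
  by exists q'.
have [|g [[pg pgG pgx] g0 gmin]] := Jmin (fun q => q != 0).
  by have [q Jq q0] := JP 0; exists q => //; apply: contraNneq q0 => ->; rewrite horner0.
have lg0 : lead_coef g != 0 by rewrite lead_coef_eq0.
have lgG := max_ring_graphV (pgG (size g).-1) lg0.
have [sg|sg] := eqVneq (size g) 1%N.
  move: lgG lg0; rewrite lead_coefE sg /= => lgG lg0.
  have pg0 : pg`_0 != 0.
    apply: contra_neq lg0 => pg0; have := pgG 0%N; rewrite pg0.
    by case: GP => _ _ _; apply.
  exists ((pg`_0)^-1 *: pg); split; first by rewrite hornerZ pgx mulr0.
    by rewrite coefZ mulVf.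
  move=> i i0; have gi : g`_i = 0 by rewrite nth_default // sg.
  have := pgG i; rewrite gi => Gi; rewrite coefZ.
  have -> : ((pg`_0)^-1 * pg`_i, 0) = ((pg`_0)^-1, (g`_0)^-1) * (pg`_i, 0).
    by rewrite mul_pair mulr0.
  by case: GP => _ _ GM _; apply: GM.
(* If [g] is not constant it has a root [w]. Subtracting a multiple of [g] from the shortest [q] in
   [J] with [q.[w] != 0] preserves the value at [w] and lowers the degree. *)
have /closed_rootP[w /rootP gw] := sg.
have [q [[p pq px] qw qmin]] := Jmin (fun q => q.[w] != 0) (JP w).
have q0 : q != 0 by apply: contraNneq qw => ->; rewrite horner0.
have sgq : (size g <= size q)%N by apply: gmin => //; exists p.
have sg0 : (0 < size g)%N by rewrite size_poly_gt0.
(* The coefficients are taken where [q] and [g] have their leading terms, even if [p] and [pg] are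
   longer, so that [a] has value [b]. *)
pose k := (size q - size g)%N; pose a := p`_(size q).-1 / pg`_(size g).-1.
pose b := q`_(size q).-1 / g`_(size g).-1.
have abG : G (a, b).
  case: GP => _ _ GM _.
  by rewrite /a /b -mul_pair; apply: GM.
pose q' := q - b *: (g * 'X^k).
have Jq' : J q'.
  exists (p - a *: (pg * 'X^k)); last first.
    by rewrite hornerD hornerN hornerZ hornerM px pgx mul0r mulr0 subrr.
  move=> i; rewrite !coefB !coefZ !coefMXn.
  case: (GP) => _ GB GM _.
  apply: (ring_graph_pairB GP) => //.
  rewrite -mul_pair; apply: GM => //.
  by case: ifP => _ //; exact: ring_graph0.
have q'w : q'.[w] != 0.
  by rewrite hornerD hornerN hornerZ hornerM gw mul0r mulr0 subr0.
have := qmin q' Jq' q'w; rewrite leqNgt => /negP[].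
have sq0 : (0 < size q)%N by rewrite size_poly_gt0.
rewrite -(prednK sq0) ltnS; apply/leq_sizeP => j jq.
rewrite coefB coefZ coefMXn.
have jk : (j < k)%N = false by apply/negbTE; rewrite -leqNgt /k; lia.
rewrite jk; have [jE|jE] := eqVneq j (size q).-1.
  have -> : (j - k = (size g).-1)%N by rewrite /k; lia.
  by rewrite jE /b divfK ?subrr // -lead_coefE.
have qj : (size q <= j)%N by rewrite leqNgt; apply: contra jE => ?; apply/eqP; lia.
have gj : (size g <= j - k)%N by rewrite /k; move: sgq sg0 qj; clear; lia.
by rewrite !nth_default ?mulr0 ?subr0.
Qed.

(** Descent on the total degree: the longer relation is shortened by a multiple of the reversal of
    the other. Its constant term still has value 1, hence is invertible with a value and can be
    normalized to 1 again. A relation of degree 0 would read [1 = 0]. *)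
Lemma max_ring_graph_integral (n m : nat) x (p q : {poly K}) :
  (size p <= n.+1)%N -> (size q <= m.+1)%N ->
  p.[x] = 0 -> p`_0 = 1 -> (forall i, (0 < i)%N -> G (p`_i, 0)) ->
  q.[x^-1] = 0 -> q`_0 = 1 -> (forall i, (0 < i)%N -> G (q`_i, 0)) -> False.
Proof.
case: (GP) => G1 GB GM G0.
have [N] := ubnP (n + m)%N; elim: N => // N IH in n m x p q *.
wlog mn : n m x p q / (m <= n)%N.
  move=> wl; case/orP: (leq_total m n) => mn; first exact: wl.
  rewrite addnC => nmN sp sq px p0 pG qx q0 qG.
  by apply: (wl m n x^-1 q p) => //; rewrite invrK.
move=> nmN sp sq px p0 pG qx q0 qG.
have constF (r : {poly K}) : (size r <= 1)%N -> r`_0 = 1 -> forall y, r.[y] = 0 -> False.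
  move=> sr r0 y; rewrite (size1_polyC sr) hornerC r0 => /eqP.
  by rewrite oner_eq0.
have x0 : x != 0.
  apply/eqP => x0; have := px; rewrite x0 horner_coef0 p0 => /eqP.
  by rewrite oner_eq0.
case: m => [|m] in mn nmN sq *; first exact: constF sq q0 _ qx.
(* [q'] is the reversal of [q], so it vanishes at [x] and has leading term ['X^m.+1]. *)
pose q' := \poly_(i < m.+2) q`_(m.+1 - i).
have q'x : q'.[x] = 0.
  rewrite horner_poly; have := congr1 (fun c => x ^+ m.+1 * c) qx.
  rewrite mulr0 (horner_coef_wide _ sq) mulr_sumr => E; rewrite -[RHS]E.
  rewrite (reindex_inj rev_ord_inj) /=; apply: eq_bigr => i _.
  have im : (i <= m.+1)%N by rewrite -ltnS.
  rewrite subSS subKn // mulrCA; congr (_ * _).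
  have -> : x ^+ m.+1 = x ^+ (m.+1 - i) * x ^+ i by rewrite -exprD subnK.
  by rewrite exprVn mulfK // expf_neq0.
pose p' := p - p`_n *: ('X^(n - m.+1) * q').
have p'x : p'.[x] = 0.
  by rewrite hornerD hornerN hornerZ hornerM px q'x !mulr0 subrr.
have coefp' i : p'`_i = p`_i - p`_n * (if (i < n - m.+1)%N then 0
     else if (i - (n - m.+1) < m.+2)%N then q`_(n - i) else 0).
  rewrite coefB coefZ coefXnM coef_poly; case: ltnP => // ni; case: ltnP => // _.
  by have -> : (m.+1 - (i - (n - m.+1)) = n - i)%N by lia.
have n0 : (0 < n)%N by lia.
have pn := pG n n0.
have sp' : (size p' <= n)%N.
  apply/leq_sizeP => j nj; rewrite coefp'; case: ltnP => [|_]; first lia.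
  case: ltnP => [h|h].
    have -> : j = n by lia.
    by rewrite subnn q0 mulr1 subrr.
  by rewrite mulr0 subr0 nth_default // (leq_trans sp) //; lia.
have p'G i : (0 < i)%N -> G (p'`_i, 0).
  move=> i0; rewrite coefp'; apply: (ring_graph_pairB0 GP); first exact: pG.
  case: ifP => _; first by rewrite mulr0; exact: ring_graph0.
  case: ifP => _; last by rewrite mulr0; exact: ring_graph0.
  have [->|ni] := posnP (n - i)%N; first by rewrite q0 mulr1.
  exact: (ring_graph_pairM0 GP pn (qG _ ni)).
have p'0 : G (p'`_0, 1).
  rewrite coefp' p0; apply: (ring_graph_pairB0 GP) => //.
  case: ifP => _; first by rewrite mulr0; exact: ring_graph0.
  by rewrite ?sub0n subn0; exact: (ring_graph_pairM0 GP pn (qG _ n0)).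
have p'00 : p'`_0 != 0.
  by apply/eqP => E; move: p'0; rewrite E => /G0/eqP; rewrite oner_eq0.
have p'V := max_ring_graphV p'0 (oner_neq0 _).
apply: (IH n.-1 m.+1 x ((p'`_0)^-1 *: p') q) => //.
- by lia.
- by rewrite prednK // (leq_trans (size_scale_leq _ _)).
- by rewrite hornerZ p'x mulr0.
- by rewrite coefZ mulVf.
- by move=> i i0; rewrite coefZ; exact: (ring_graph_pairM0 GP p'V (p'G i i0)).
Qed.

(* Chevalley's extension theorem: the graph is that of a place of [K]. *)
Lemma max_ring_graph_place x : (exists w, G (x, w)) \/ G (x^-1, 0).
Proof.
have [?|nx] := pselect (exists w, G (x, w)); [by left|right].
have [[w xw]|nxV] := pselect (exists w, G (x^-1, w)).
  have [<-//|w0] := eqVneq w 0; case: nx; exists w^-1.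
  by rewrite -[x]invrK; apply: max_ring_graphV.
have [|p [px p0 pG]] := @max_ring_graph_relation x; first by move=> w ?; apply: nx; exists w.
have [|q [qx q0 qG]] := @max_ring_graph_relation x^-1.
  by move=> w ?; apply: nxV; exists w.
by have := @max_ring_graph_integral (size p) (size q) x p q; case; rewrite ?leqnSn.
Qed.

End MaxRingGraph.
End Places.

(** * Specialization of subrepresentations along a place *)

Definition qrep (R : Type) (Q : quiver) (n : dimvec Q) :=
  forall a : arrow Q, 'M[R]_(n (source a), n (target a)).

(** Matrices act on row vectors: the rows of [S x] are a basis of the subspace at [x], and [X] is
    the induced representation. Stability is thus an equation between matrices, which a ring
    morphism can transport. *)
Definition has_subrep (F : fieldType) (Q : quiver) (n : dimvec Q)
    (v : qrep F n) (b : dimvec Q) :=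
  exists S : forall x, 'M[F]_(b x, n x), (forall x, row_free (S x)) /\
  exists X : qrep F b, forall a, S (source a) *m v a = X a *m S (target a).

(** Cramer's rule: the columns other than [i] are those of the identity, so the expansion along
    column [i] has a single nonzero cofactor. *)
Lemma det_colsub_replace (R : comNzRingType) r n (X : 'M[R]_(r, n))
    (f : 'I_r -> 'I_n) i j :
  colsub f X = 1%:M ->
  \det (colsub (fun k => if k == i then j else f k) X) = X i j.
Proof.
move=> fX; set A := colsub _ X.
have cofE k : cofactor A k i = (k == i)%:R.
  transitivity (\adj (1%:M : 'M[R]_r) i k); last by rewrite adj1 !mxE eq_sym.
  rewrite mxE; congr (_ * \det _); apply/matrixP => k' l; rewrite -fX !mxE.
  by rewrite eq_sym (negPf (neq_lift _ _)).
rewrite (expand_det_col _ i) (bigD1 i) //= big1 => [|k ki]; rewrite cofE.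
  by rewrite !mxE !eqxx mulr1 addr0.
by rewrite (negPf ki) mulr0.
Qed.

Lemma dependent_choice (T : Type) (U : T -> Type) (P : forall x, U x -> Prop) :
  (forall x, exists y, P x y) -> exists f, forall x, P x (f x).
Proof. by move=> PP; exists (fun x => sval (cid (PP x))) => x; case: cid. Qed.

Section Specialization.
Variables (K : fieldType) (L : closedFieldType) (G : set (K * L)).
Hypothesis Gmax : max_ring_graph G.
Let GP : ring_graph G := proj1 Gmax.

(** For the valuation attached to the place, [d i] is an entry of largest absolute value. *)
Lemma place_largest (T : eqType) (d : T -> K) (s : seq T) (i0 : T) : d i0 != 0 ->
  exists2 i, d i != 0 & forall j, j \in i0 :: s -> exists w, G (d j / d i, w).
Proof.
case: (GP) => G1 _ GM _ di0; elim: s => [|j s [i di iP]].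
  by exists i0 => // j; rewrite inE => /eqP ->; exists 1; rewrite divff.
have [[w ji]|ij] := max_ring_graph_place Gmax (d j / d i).
  exists i => // k; rewrite !inE orbCA => /predU1P[->|ks]; first by exists w.
  by apply: iP; rewrite inE.
have [dj|dj] := eqVneq (d j) 0.
  exists i => // k; rewrite !inE orbCA => /predU1P[->|ks]; last by apply: iP; rewrite inE.
  by exists 0; rewrite dj mul0r; exact: ring_graph0.
exists j => // k; rewrite !inE orbCA => /predU1P[->|ks]; first by exists 1; rewrite divff.
have [|w kiG] := iP k; first by rewrite inE.
exists (w * 0).
have -> : d k / d j = d k / d i * (d j / d i)^-1 by rewrite invf_div mulrA divfK.
by rewrite -mul_pair; apply: GM.
Qed.

(* Normalize by a maximal minor of largest value: by Cramer's rule all the entries are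
   then quotients of minors by that one, hence have a value. *)
Lemma place_row_free r n (S : 'M[K]_(r, n)) : row_free S ->
  exists g : 'M[K]_r, exists f : 'I_r -> 'I_n, [/\ g \in unitmx,
    colsub f (g *m S) = 1%:M & forall i j, exists w, G ((g *m S) i j, w)].
Proof.
move=> Sfree; pose d (f : {ffun 'I_r -> 'I_n}) := \det (colsub f S).
have [f0 df0] : exists f, d f != 0.
  have rfS : row_full S^T by rewrite /row_full mxrank_tr.
  exists (fullrankfun rfS); rewrite /d -det_tr -unitfE -unitmxE.
  by have := fullrowsub_unit rfS; congr (_ \in unitmx); apply/matrixP => i j; rewrite !mxE.
have [f df fP] := @place_largest _ d (enum {ffun 'I_r -> 'I_n}) f0 df0.
have gu : colsub f S \in unitmx by rewrite unitmxE unitfE.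
have fE : colsub f (invmx (colsub f S) *m S) = 1%:M.
  by rewrite -mulmx_colsub mulVmx.
exists (invmx (colsub f S)), f; split=> //; first by rewrite unitmx_inv.
move=> i j; rewrite -(det_colsub_replace i j fE) -mulmx_colsub det_mulmx det_inv mulrC.
have [|w wG] := fP [ffun k => if k == i then j else f k]; first by rewrite inE mem_enum orbT.
exists w; rewrite /d in wG; move: wG; congr (G (_ / _, _)); congr (\det _).
by apply/matrixP => k l; rewrite !mxE ffunE.
Qed.

Lemma ring_graph_mulmx m n p (A : 'M[K]_(m, n)) (B : 'M[K]_(n, p))
    (A' : 'M[L]_(m, n)) (B' : 'M[L]_(n, p)) :
  (forall i j, G (A i j, A' i j)) -> (forall i j, G (B i j, B' i j)) ->
  forall i j, G ((A *m B) i j, (A' *m B') i j).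
Proof.
move=> AG BG i j; rewrite !mxE.
have -> : (\sum_k A i k * B k j, \sum_k A' i k * B' k j) =
    \sum_k (A i k * B k j, A' i k * B' k j) :> K * L.
  by rewrite [RHS]surjective_pairing (raddf_sum fst) (raddf_sum snd).
apply: ring_graph_sum => // k _; rewrite -mul_pair.
by case: (GP) => _ _ GM _; apply: GM.
Qed.

Lemma ring_graph_inj x y y' : G (x, y) -> G (x, y') -> y = y'.
Proof.
move=> xy xy'; case: (GP) => _ _ _ G0; apply/eqP; rewrite -subr_eq0; apply/eqP.
by apply: G0; rewrite -(subrr x); apply: ring_graph_pairB.
Qed.

(** The normalized basis contains an identity block, which the place preserves, so the specialized
    rows stay independent. The induced representation has values because it can be read off the
    pivot columns. *)
Lemma has_subrep_place Q (n b : dimvec Q) (v : qrep K n) (v' : qrep L n) :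
  (forall a i j, G (v a i j, v' a i j)) -> has_subrep v b -> has_subrep v' b.
Proof.
move=> vv' [S [Sfree [X SX]]].
have [g gP] := dependent_choice (fun x => place_row_free (Sfree x)).
have [f fP] := dependent_choice gP.
have [T TG] : exists T : forall x, 'M[L]_(b x, n x),
    forall x i j, G ((g x *m S x) i j, T x i j).
  apply: (@dependent_choice _ (fun x => 'M[L]_(b x, n x))
    (fun x T => forall i j, G ((g x *m S x) i j, T i j))) => x; have [_ _ tG] := fP x.
  have [T TG] := choice (fun ij : 'I_(b x) * 'I_(n x) => tG ij.1 ij.2).
  by exists (\matrix_(i, j) T (i, j)) => i j; rewrite mxE; exact: (TG (i, j)).
pose Y a := g (source a) *m X a *m invmx (g (target a)).
have YE a : (g (source a) *m S (source a)) *m v a = Y a *m (g (target a) *m S (target a)).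
  by have [gu _ _] := fP (target a); rewrite -mulmxA SX /Y !mulmxA mulmxKV.
have colY a : colsub (f (target a)) (g (source a) *m S (source a) *m v a) = Y a.
  by have [_ fE _] := fP (target a); rewrite YE -mulmx_colsub fE mulmx1.
pose Y' a := colsub (f (target a)) (T (source a) *m v' a).
have YG a i j : G (Y a i j, Y' a i j).
  rewrite -colY [X in G (X, _)]mxE [X in G (_, X)]mxE.
  exact: (ring_graph_mulmx (TG _) (vv' a)).
exists T; split.
  move=> x; apply/row_freeP; exists (\matrix_(j, i) (j == f x i)%:R).
  have [_ fE _] := fP x; apply/matrixP => i j; rewrite mxE.
  rewrite (bigD1 (f x j)) //= mxE eqxx mulr1 big1 ?addr0 => [|k kf]; last first.
    by rewrite mxE (negPf kf) mulr0.
  apply: (@ring_graph_inj (colsub (f x) (g x *m S x) i j)); first by rewrite mxE.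
  by rewrite fE !mxE; case: eqP => _; [case: GP|exact: ring_graph0].
exists Y' => a; apply/matrixP => i j.
apply: (@ring_graph_inj ((g (source a) *m S (source a) *m v a) i j)).
  exact: (ring_graph_mulmx (TG _) (vv' a)).
by rewrite YE; apply: (ring_graph_mulmx (YG a) (TG _)).
Qed.
End Specialization.

Lemma has_subrep_specialize (K : fieldType) (L : closedFieldType) (G : set (K * L))
    (Q : quiver) (n b : dimvec Q) (v : qrep K n) (v' : qrep L n) :
  ring_graph G -> (forall a i j, G (v a i j, v' a i j)) ->
  has_subrep v b -> has_subrep v' b.
Proof.
move=> /ring_graph_extends[H [GH Hmax]] vv'.
by apply: (has_subrep_place Hmax) => a i j; apply: GH.
Qed.

(** * Necessity of (A) *)

Section PolynomialCharts.
Variable F : numFieldType.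

Section PolyFun.
Variable P : finType.
Implicit Types (g h : (P -> F) -> F) (d e : nat).

(** The bound is on the degree in each variable separately, so that the monomials are indexed by
    [{ffun P -> 'I_d.+1}]. *)
Definition polyfun d g :=
  exists s : seq (F * {ffun P -> nat}),
    (forall t, t \in s -> forall p, (t.2 p <= d)%N) /\
    forall x, g x = \sum_(t <- s) t.1 * \prod_p x p ^+ t.2 p.

Lemma polyfun_ext d g h : g =1 h -> polyfun d g -> polyfun d h.
Proof. by move=> gh [s [sd sE]]; exists s; split=> // x; rewrite -gh sE. Qed.

Lemma polyfun_leq d e g : (d <= e)%N -> polyfun d g -> polyfun e g.
Proof.
move=> de [s [sd sE]]; exists s; split=> // t ts p.
exact: leq_trans (sd t ts p) de.
Qed.

Lemma polyfun_const d c : polyfun d (fun=> c).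
Proof.
exists [:: (c, [ffun=> 0%N])]; split=> [t|x].
  by rewrite inE => /eqP -> p; rewrite ffunE.
by rewrite big_seq1 /= big1 ?mulr1 // => p _; rewrite ffunE.
Qed.

Lemma polyfun_var p : polyfun 1 (fun x => x p).
Proof.
exists [:: (1, [ffun q => (q == p)%N : nat])]; split=> [t|x].
  by rewrite inE => /eqP -> q; rewrite ffunE; case: eqP.
rewrite big_seq1 /= mul1r (bigD1 p) //= ffunE eqxx expr1 big1 ?mulr1 // => q qp.
by rewrite ffunE (negPf qp) expr0.
Qed.

Lemma polyfunD d g h : polyfun d g -> polyfun d h -> polyfun d (fun x => g x + h x).
Proof.
move=> [s [sd sE]] [r [rd rE]]; exists (s ++ r); split=> [t|x].
  by rewrite mem_cat => /orP[]; [exact: sd|exact: rd].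
by rewrite big_cat sE rE.
Qed.

Lemma polyfunM d e g h :
  polyfun d g -> polyfun e h -> polyfun (d + e) (fun x => g x * h x).
Proof.
move=> [s [sd sE]] [r [rd rE]].
pose m (t u : F * {ffun P -> nat}) := (t.1 * u.1, [ffun p => t.2 p + u.2 p]%N).
exists [seq m t u | t <- s, u <- r]; split.
  move=> _ /allpairsP[[t u] /= [ts ur ->]] p; rewrite ffunE.
  by rewrite leq_add ?sd ?rd.
move=> x; rewrite sE rE big_allpairs_dep mulr_suml; apply: eq_bigr => t _.
rewrite mulr_sumr; apply: eq_bigr => u _ /=.
rewrite mulrACA -big_split; congr (_ * _); apply: eq_bigr => p _.
by rewrite ffunE exprD.
Qed.

Lemma polyfunN d g : polyfun d g -> polyfun d (fun x => - g x).
Proof.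
move=> gd; apply: polyfun_ext (polyfunM (polyfun_const 0 (-1)) gd) => x.
by rewrite mulN1r.
Qed.

Lemma polyfun_sum (I : Type) (r : seq I) (A : pred I) d (g : I -> (P -> F) -> F) :
  (forall i, polyfun d (g i)) -> polyfun d (fun x => \sum_(i <- r | A i) g i x).
Proof.
move=> gd; elim: r => [|i r IH].
  by apply: polyfun_ext (polyfun_const d 0) => x; rewrite big_nil.
apply: (@polyfun_ext _ (fun x => (if A i then g i x else 0)
    + \sum_(j <- r | A j) g j x)).
  by move=> x; rewrite big_cons; case: ifP => _; rewrite ?add0r.
by apply: polyfunD IH; case: (A i); [exact: gd|exact: polyfun_const].
Qed.

Lemma polyfun_prod (I : Type) (r : seq I) (A : pred I) d (g : I -> (P -> F) -> F) :
  (forall i, polyfun d (g i)) ->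
  polyfun (d * size r) (fun x => \prod_(i <- r | A i) g i x).
Proof.
move=> gd; elim: r => [|i r IH] /=.
  by rewrite muln0; apply: polyfun_ext (polyfun_const 0 1) => x; rewrite big_nil.
apply: (@polyfun_ext _ (fun x => (if A i then g i x else 1)
    * \prod_(j <- r | A j) g j x)).
  by move=> x; rewrite big_cons; case: ifP => _; rewrite ?mul1r.
by rewrite mulnS; apply: polyfunM IH; case: (A i); [exact: gd|exact: polyfun_const].
Qed.

Lemma polyfun_coef d g : polyfun d g ->
  exists c : {ffun P -> 'I_d.+1} -> F,
    forall x, g x = \sum_k c k * \prod_p x p ^+ k p.
Proof.
case=> s [sd sE].
exists (fun k => \sum_(t <- s | k == [ffun p => inord (t.2 p)]) t.1) => x.
under [RHS]eq_bigr do rewrite mulr_suml.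
rewrite (exchange_big_dep predT) //= sE big_seq [RHS]big_seq.
apply: eq_bigr => t ts; rewrite big_pred1_eq; congr (_ * _).
by apply: eq_bigr => p _; rewrite ffunE inordK // ltnS sd.
Qed.

(* The functions [h i] are linearly independent, whereas there are only
   [d.+1 ^ #|P|] monomials. *)
Lemma polyfun_separated d N (h : 'I_N -> (P -> F) -> F) (x : 'I_N -> P -> F) :
  (forall i, polyfun d (h i)) -> (forall i, h i (x i) != 0) ->
  (forall i j, i != j -> h i (x j) = 0) -> (N <= d.+1 ^ #|P|)%N.
Proof.
move=> hd hi hij; have [c cE] := choice (fun i => polyfun_coef (hd i)).
pose C : 'M[F]_(N, #|{ffun P -> 'I_d.+1}|) := \matrix_(i, k) c i (enum_val k).
pose X : 'M[F]_(#|{ffun P -> 'I_d.+1}|, N) :=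
  \matrix_(k, j) \prod_p x j p ^+ (enum_val k : {ffun P -> 'I_d.+1}) p.
have CX : C *m X = diag_mx (\row_i h i (x i)).
  apply/matrixP => i j; rewrite !mxE.
  transitivity (h i (x j)).
    rewrite cE [RHS](reindex_onto enum_val enum_rank) /= => [|k _]; last by rewrite enum_rankK.
    apply: eq_big => [k|k _]; last by rewrite !mxE.
    by rewrite enum_valK eqxx.
  by have [->|/hij] := eqVneq i j; rewrite ?mulr1n.
have : row_free (C *m X).
  rewrite row_free_unit unitmxE unitfE CX det_diag; apply/prodf_neq0 => i _.
  by rewrite mxE.
have <- : #|{ffun P -> 'I_d.+1}| = (d.+1 ^ #|P|)%N by rewrite card_ffun card_ord.
rewrite -row_leq_rank => /leq_trans; apply.
exact: leq_trans (mxrankM_maxl _ _) (rank_leq_col _).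
Qed.
End PolyFun.

(* Count the points of the grid [0, q - 1]^Y that each chart covers: they are separated by
   polynomial functions on [P] of degree [O(q)], hence there are [O(q ^ #|P|)] of them. *)
Lemma polyfun_cover (P Y I : finType) d (f : I -> (P -> F) -> Y -> F) :
  (forall i y, polyfun d (fun x => f i x y)) ->
  (forall z : Y -> F, exists i x, f i x =1 z) -> (#|Y| <= #|P|)%N.
Proof.
move=> fd fcov; rewrite leqNgt; apply/negP => PY.
suff bound q : (q ^ #|Y| <= #|I| * (d * q * #|Y|).+1 ^ #|P|)%N.
  (* For this [q], the right side of the bound is at most [#|I| * (c * q) ^ #|P|], which is less
     than [q ^ (#|P| + 1)]. *)
  pose c := (d * #|Y|).+1; have := bound (#|I| * c ^ #|P|).+1.
  set q := _.+1; apply/negP; rewrite -ltnNge.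
  have q0 : (0 < q)%N by [].
  apply: (@leq_ltn_trans (#|I| * (c * q) ^ #|P|)).
    rewrite leq_mul2l; apply/orP; right; case: #|P| => // p.
    by rewrite leq_exp2r // /c; nia.
  rewrite expnMn mulnA; apply: (@leq_trans (q * q ^ #|P|)).
    by rewrite ltn_mul2r expn_gt0 q0 ltnSn.
  by rewrite -(expnS q #|P|) leq_pexp2l.
have [ix ixP] := choice (fun e : {ffun Y -> 'I_q} => fcov (fun y => (e y)%:R)).
have [x xP] := choice ixP.
have -> : (q ^ #|Y|)%N = #|{ffun Y -> 'I_q}| by rewrite card_ffun card_ord.
rewrite -sum1_card (partition_big ix predT) //= -sum_nat_const leq_sum // => i _.
pose E : pred {ffun Y -> 'I_q} := fun e => ix e == i.
rewrite sum1_card -[#|_|]/#|E|.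
have size_index (T : finType) : size (index_enum T) = #|T|.
  by rewrite [index_enum T]unlock -enumT -cardT.
(* As in Lagrange interpolation, [h a] vanishes at every grid point except the one numbered [a]. *)
pose h (a : 'I_#|E|) (u : P -> F) := \prod_(y : Y)
  \prod_(k < q | k != (enum_val a : {ffun Y -> 'I_q}) y) (f i u y - k%:R).
have natF (a b : nat) : (a%:R - b%:R == 0 :> F) = (a == b) by rewrite subr_eq0 eqr_nat.
have fx (a : 'I_#|E|) : f i (x (enum_val a)) =1 fun y => ((enum_val a : {ffun Y -> 'I_q}) y)%:R.
  have /eqP aE : ix (enum_val a) == i by exact: (enum_valP a).
  by have := xP (enum_val a); rewrite aE.
apply: (@polyfun_separated _ _ _ h (fun a => x (enum_val a))).
- move=> a; rewrite -[q in (d * q)%N]card_ord -!size_index.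
  do 2 (apply: polyfun_prod => ?); apply: polyfunD; first exact: fd.
  exact: polyfun_const.
- move=> a; apply/prodf_neq0 => y _; apply/prodf_neq0 => k ky.
  by rewrite fx natF eq_sym.
move=> a b ab; have /existsP[y yab] : [exists y,
    (enum_val a : {ffun Y -> 'I_q}) y != (enum_val b : {ffun Y -> 'I_q}) y].
  apply: contraR ab; rewrite negb_exists => /forallP abE.
  apply/eqP/enum_val_inj/ffunP => y; apply/eqP; have := abE y.
  by rewrite negbK.
rewrite /h (bigD1 y) //= (bigD1 ((enum_val b : {ffun Y -> 'I_q}) y)) /=; last by rewrite eq_sym.
by rewrite fx subrr !mul0r.
Qed.
End PolynomialCharts.

Lemma card_sigma (I : finType) (T : I -> finType) :
  #|{: {i : I & T i}}| = (\sum_i #|T i|)%N.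
Proof. by rewrite card_tagged sumnE big_map big_enum. Qed.

Definition gen_subrep (F : fieldType) (Q : quiver) (b n : dimvec Q) :=
  dimvec_le b n /\ forall v : qrep F n, has_subrep v b.

Section PolynomialMatrices.
Variables (F : numFieldType) (P : finType).

Definition polymx d m n (A : (P -> F) -> 'M[F]_(m, n)) :=
  forall i j, polyfun d (fun u => A u i j).

Lemma polymx_const d m n (A : 'M[F]_(m, n)) : polymx d (fun=> A).
Proof. by move=> i j; exact: polyfun_const. Qed.

Lemma polymx_leq d e m n (A : (P -> F) -> 'M[F]_(m, n)) :
  (d <= e)%N -> polymx d A -> polymx e A.
Proof. by move=> de Ad i j; apply: polyfun_leq (Ad i j). Qed.

Lemma polymxD d m n (A B : (P -> F) -> 'M[F]_(m, n)) :
  polymx d A -> polymx d B -> polymx d (fun u => A u + B u).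
Proof.
move=> Ad Bd i j; apply: polyfun_ext (polyfunD (Ad i j) (Bd i j)) => u.
by rewrite mxE.
Qed.

Lemma polymxN d m n (A : (P -> F) -> 'M[F]_(m, n)) :
  polymx d A -> polymx d (fun u => - A u).
Proof.
by move=> Ad i j; apply: polyfun_ext (polyfunN (Ad i j)) => u; rewrite mxE.
Qed.

Lemma polymxM d e m n p (A : (P -> F) -> 'M[F]_(m, n)) (B : (P -> F) -> 'M[F]_(n, p)) :
  polymx d A -> polymx e B -> polymx (d + e) (fun u => A u *m B u).
Proof.
move=> Ad Be i j.
apply: (@polyfun_ext _ _ _ (fun u => \sum_k A u i k * B u k j)).
  by move=> u; rewrite mxE.
by apply: polyfun_sum => k; apply: polyfunM.
Qed.

Lemma polymx_var m n (p : 'I_m -> 'I_n -> P) :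
  polymx 1 (fun u : P -> F => \matrix_(i, j) u (p i j)).
Proof.
by move=> i j; apply: polyfun_ext (polyfun_var F (p i j)) => u; rewrite mxE.
Qed.
End PolynomialMatrices.

Lemma row_free_pivots (F : fieldType) r n (S : 'M[F]_(r, n)) : row_free S ->
  exists g : 'M[F]_r, exists f : 'I_r -> 'I_n,
    [/\ g \in unitmx, injective f & colsub f (g *m S) = 1%:M].
Proof.
move=> Sfree; have rfS : row_full S^T by rewrite /row_full mxrank_tr.
have uS : colsub (fullrankfun rfS) S \in unitmx.
  have := fullrowsub_unit rfS; rewrite -unitmx_tr; congr (_ \in unitmx).
  by apply/matrixP => i j; rewrite !mxE.
exists (invmx (colsub (fullrankfun rfS) S)), (fullrankfun rfS).
split; [by rewrite unitmx_inv|exact: fullrankfun_inj|].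
by rewrite -mulmx_colsub mulVmx.
Qed.

(** Matrices over [bool] form a finite type, hence can index finitely many charts. *)
Definition boolmx (F : fieldType) m n (A : 'M[bool]_(m, n)) : 'M[F]_(m, n) :=
  map_mx (fun c : bool => c%:R) A.

(** [A.1] selects the pivot coordinates and [A.2] the remaining ones; the two coordinate projections
    add up to the identity. *)
Lemma boolmx_complement (F : fieldType) r n (f : 'I_r -> 'I_n) : injective f ->
  exists A : 'M[bool]_(r, n) * 'M[bool]_(n - r, n),
    boolmx F A.1 = rowsub f 1%:M /\
    (boolmx F A.1)^T *m boolmx F A.1 + (boolmx F A.2)^T *m boolmx F A.2 = 1%:M.
Proof.
move=> finj; pose D := ~: [set f i | i in 'I_r].
have cD : #|D| = (n - r)%N.
  by rewrite cardsCs finset.setCK card_imset // !card_ord.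
pose h (j : 'I_(n - r)) : 'I_n := enum_val (cast_ord (esym cD) j).
have hinj : injective h by move=> i j /enum_val_inj/cast_ord_inj.
exists (\matrix_(i, k) (f i == k), \matrix_(j, k) (h j == k)); split.
  by apply/matrixP => i k; rewrite !mxE.
apply/matrixP => k l; rewrite !mxE.
have one m (u : 'I_m -> 'I_n) : injective u ->
    \sum_i (boolmx F (\matrix_(i, k) (u i == k)))^T k i * boolmx F (\matrix_(i, k) (u i == k)) i l
    = ((k == l) && (k \in codom u))%:R.
  move=> uinj; have [/codomP[i ->]|ku] := boolP (k \in codom u).
    rewrite (bigD1 i) //= big1 ?addr0 => [|j ji]; first by rewrite !mxE eqxx mul1r andbT.
    by rewrite !mxE (inj_eq uinj) (negPf ji) mul0r.
  rewrite andbF big1 // => i _; rewrite !mxE; case: eqP => [E|_]; last by rewrite mul0r.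
  by case/negP: ku; rewrite -E codom_f.
rewrite /= (one _ f finj) (one _ h hinj).
have -> : (k \in codom h) = (k \notin codom f).
  have -> : (k \notin codom f) = (k \in D).
    by rewrite !inE; congr (~~ _); apply/codomP/imsetP => [[i ->]|[i _ ->]]; exists i.
  apply/codomP/idP => [[j ->]|kD]; first exact: enum_valP.
  exists (cast_ord cD (enum_rank_in kD k)).
  by rewrite /h cast_ordK enum_rankK_in.
by case: (k == l); case: (k \in codom f); rewrite ?addr0 ?add0r.
Qed.

(* A representation with a subrepresentation spanned by matrices in echelon form is
   determined by their free entries [Y], by the restriction [X] and by the rows [W] off
   the pivots; this parametrizes all representations by finitely many charts. *)
Lemma gen_subrep_euler_ge0 (F : numFieldType) (Q : quiver) (b n : dimvec Q) :
  gen_subrep F b n ->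
  (\sum_a b (source a) * (n (target a) - b (target a)) <=
   \sum_x b x * (n x - b x))%N.
Proof.
case=> bn gen.
pose P : finType := ({x : vertex Q & 'I_(b x) * 'I_(n x - b x)} +
  ({a : arrow Q & 'I_(b (source a)) * 'I_(b (target a))} +
   {a : arrow Q & 'I_(n (source a) - b (source a)) * 'I_(n (target a))}))%type.
pose Y : finType := {a : arrow Q & 'I_(n (source a)) * 'I_(n (target a))}%type.
pose I : finType := {dffun forall x : vertex Q,
  ('M[bool]_(b x, n x) * 'M[bool]_(n x - b x, n x))%type}.
pose Ym (u : P -> F) x : 'M[F]_(b x, n x - b x) :=
  \matrix_(i, j) u (inl (existT _ x (i, j))).
pose Xm (u : P -> F) a : 'M[F]_(b (source a), b (target a)) :=
  \matrix_(i, j) u (inr (inl (existT _ a (i, j)))).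
pose Wm (u : P -> F) a : 'M[F]_(n (source a) - b (source a), n (target a)) :=
  \matrix_(i, j) u (inr (inr (existT _ a (i, j)))).
pose A (c : I) x := boolmx F (c x).1; pose H (c : I) x := boolmx F (c x).2.
(* Here [v = A^T A v + H^T H v], where [H v = W]. The echelon basis [T = A + Y H] satisfies
   [T v = X T], whence [A v = X T - Y W]. *)
pose f (c : I) (u : P -> F) a : 'M[F]_(n (source a), n (target a)) :=
  (A c (source a))^T *m (Xm u a *m (A c (target a) + Ym u (target a) *m H c (target a))
     + - (Ym u (source a) *m Wm u a)) + (H c (source a))^T *m Wm u a.
have YP : (#|Y| <= #|P|)%N.
  apply: (@polyfun_cover F P Y I 3 (fun c u y => f c u (tag y) (tagged y).1 (tagged y).2)).
    move=> c [a [i j]] /=; move: i j; rewrite -/(polymx 3 (fun u => f c u a)).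
    have Yp x : polymx 1 (Ym^~ x) by apply: polymx_var.
    have Xp a' : polymx 1 (Xm^~ a') by apply: polymx_var.
    have Wp a' : polymx 1 (Wm^~ a') by apply: polymx_var.
    apply: polymxD.
      apply: (@polymxM _ _ 0 3); first exact: polymx_const.
      apply: polymxD.
        apply: (@polymxM _ _ 1 2); first exact: Xp.
        apply: polymxD; first exact: polymx_const.
        apply: (@polymxM _ _ 1 1); first exact: Yp.
        exact: polymx_const.
      by apply: polymxN; apply: (@polymx_leq _ _ 2) => //; apply: (@polymxM _ _ 1 1).
    by apply: (@polymx_leq _ _ 1) => //; apply: (@polymxM _ _ 0 1) => //; exact: polymx_const.
  move=> z; pose v : qrep F n := fun a => \matrix_(i, j) z (existT _ a (i, j)).
  have [S [Sfree [X SX]]] := gen v.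
  have [g gP] := dependent_choice (fun x => row_free_pivots (Sfree x)).
  have [p pP] := dependent_choice gP.
  have [c cP] := dependent_choice (fun x =>
    boolmx_complement F (let: And3 _ pinj _ := pP x in pinj)).
  pose T x := g x *m S x; pose X' a := g (source a) *m X a *m invmx (g (target a)).
  have TX a : T (source a) *m v a = X' a *m T (target a).
    by have [gu _ _] := pP (target a); rewrite /T -mulmxA SX /X' !mulmxA mulmxKV.
  pose c' : I := [ffun x => c x].
  have AH x : (A c' x)^T *m A c' x + (H c' x)^T *m H c' x = 1%:M.
    by rewrite /A /H ffunE; case: (cP x).
  have TA x : T x *m (A c' x)^T = 1%:M.
    have [_ _ <-] := pP x; have [cE _] := cP x; rewrite /A ffunE cE.
    by rewrite -[X in colsub _ X]mulmx1 -mulmx_colsub; congr (_ *m _);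
      apply/matrixP => i j; rewrite !mxE eq_sym.
  have TE x : T x = A c' x + T x *m (H c' x)^T *m H c' x.
    by rewrite -[LHS]mulmx1 -(AH x) mulmxDr !mulmxA TA mul1mx.
  pose u (q : P) : F := match q with
    | inl (existT x (i, j)) => (T x *m (H c' x)^T) i j
    | inr (inl (existT a (i, j))) => X' a i j
    | inr (inr (existT a (i, j))) => (H c' (source a) *m v a) i j
    end.
  have uY x : Ym u x = T x *m (H c' x)^T by apply/matrixP => i j; rewrite [LHS]mxE.
  have uX a : Xm u a = X' a by apply/matrixP => i j; rewrite [LHS]mxE.
  have uW a : Wm u a = H c' (source a) *m v a by apply/matrixP => i j; rewrite [LHS]mxE.
  exists c', u; case=> a [i j] /=; rewrite /f uX uY uW.
  transitivity (v a i j); last by rewrite mxE.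
  congr (fun_of_matrix _ i j); rewrite uY -TE -TX.
  rewrite {1}(TE (source a)) mulmxDl -!mulmxA addrK !mulmxA -mulmxDl AH.
  by rewrite mul1mx.
move: YP; rewrite !card_sum !card_sigma.
under eq_bigr do rewrite card_prod !card_ord.
under [X in (_ <= X + _)%N]eq_bigr do rewrite card_prod !card_ord.
under [X in (_ <= _ + (X + _))%N]eq_bigr do rewrite card_prod !card_ord.
under [X in (_ <= _ + (_ + X))%N]eq_bigr do rewrite card_prod !card_ord.
rewrite -big_split /= => le.
(* On an arrow from [s] to [t], [n_s n_t = b_s (n_t - b_t) + b_s b_t + (n_s - b_s) n_t]. *)
rewrite -(leq_add2r (\sum_a (b (source a) * b (target a) +
  (n (source a) - b (source a)) * n (target a)))%N) -big_split /=.
apply: leq_trans le; rewrite leq_eqVlt; apply/orP; left; apply/eqP.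
apply: eq_bigr => a _; have := bn (source a); have := bn (target a).
by nia.
Qed.

(** * Morphisms and extensions *)

Section Families.
Variables (R : comNzRingType) (I : finType) (m n : I -> nat).
Let T : finType := {i : I & 'I_(m i) * 'I_(n i)}%type.

(** Flattening turns a linear map between families into a single matrix, to which rank arguments
    apply. *)
Definition fam_row (A : forall i, 'M[R]_(m i, n i)) : 'rV[R]_#|T| :=
  \row_k A (tag (enum_val k : T)) (tagged (enum_val k : T)).1 (tagged (enum_val k : T)).2.

Definition row_fam (u : 'rV[R]_#|T|) i : 'M[R]_(m i, n i) :=
  \matrix_(p, q) u 0 (enum_rank (existT _ i (p, q) : T)).

Lemma fam_rowK A i : row_fam (fam_row A) i = A i.
Proof. by apply/matrixP => p q; rewrite !mxE enum_rankK. Qed.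

Lemma row_famK u : fam_row (row_fam u) = u.
Proof.
apply/rowP => k; rewrite !mxE -[in RHS](enum_valK k).
by case: (enum_val k) => i [p q].
Qed.

Lemma eq_fam_row A B : (forall i, A i = B i) -> fam_row A = fam_row B.
Proof. by move=> AB; apply/rowP => k; rewrite !mxE AB. Qed.

Lemma fam_rowP t A B : fam_row (fun i => t *: A i + B i) = t *: fam_row A + fam_row B.
Proof. by apply/rowP => k; rewrite !mxE. Qed.

Lemma row_famP t u w i : row_fam (t *: u + w) i = t *: row_fam u i + row_fam w i.
Proof. by apply/matrixP => p q; rewrite !mxE. Qed.

Lemma row_fam0 i : row_fam 0 i = 0.
Proof. by apply/matrixP => p q; rewrite !mxE. Qed.

Lemma card_fam : #|T| = (\sum_i m i * n i)%N.
Proof. by rewrite card_sigma; apply: eq_bigr => i _; rewrite card_prod !card_ord. Qed.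
End Families.

Section HomExt.
Variables (F : fieldType) (Q : quiver) (al ga : dimvec Q).
Implicit Types (v : qrep F al) (w : qrep F ga).

Definition hom_diff v w (phi : forall x, 'M[F]_(al x, ga x)) (a : arrow Q) :=
  phi (source a) *m w a - v a *m phi (target a).

Definition hom_diff_row v w (u : 'rV[F]_#|{: {x : vertex Q & 'I_(al x) * 'I_(ga x)}}|) :=
  fam_row (hom_diff v w (row_fam u)).

Fact hom_diff_row_linear v w : linear (hom_diff_row v w).
Proof.
move=> t u u'; rewrite /hom_diff_row -fam_rowP; apply: eq_fam_row => a.
rewrite /hom_diff !row_famP mulmxDl mulmxDr -scalemxAl -scalemxAr scalerBr opprD.
by rewrite addrACA.
Qed.
HB.instance Definition _ v w := GRing.isLinear.Build F _ _ _ (hom_diff_row v w)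
  (hom_diff_row_linear v w).

(* Its kernel is [Hom(v, w)] and its cokernel is [Ext(v, w)]. *)
Definition hom_diff_mx v w := lin1_mx (hom_diff_row v w).

Lemma mul_hom_diff_mx v w u : u *m hom_diff_mx v w = fam_row (hom_diff v w (row_fam u)).
Proof. by rewrite mul_rV_lin1. Qed.

Lemma hom_diff_mxP v w :
  reflect (forall chi : forall a, 'M[F]_(al (source a), ga (target a)),
             exists phi, forall a, hom_diff v w phi a = chi a)
          (row_full (hom_diff_mx v w)).
Proof.
apply: (iffP row_fullP) => [[B BD] chi|surj].
  exists (row_fam (fam_row chi *m B)) => a.
  rewrite -[LHS](fam_rowK (hom_diff v w _)) -mul_hom_diff_mx -mulmxA BD mulmx1.
  exact: fam_rowK.
suff sub : (1%:M <= hom_diff_mx v w)%MS by have [B ->] := submxP sub; exists B.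
apply/row_subP => k; have [phi phiE] := surj (row_fam (row k 1%:M)).
apply/submxP; exists (fam_row phi); rewrite mul_hom_diff_mx -[LHS]row_famK.
by apply: eq_fam_row => a; rewrite -phiE /hom_diff !fam_rowK.
Qed.

Definition rep_line (n : dimvec Q) (v dv : qrep F n) (t : F) : qrep F n := fun a => v a + t *: dv a.

Lemma hom_diff_mx_line v w dv dw t :
  hom_diff_mx (rep_line v dv t) (rep_line w dw t) =
  hom_diff_mx v w + t *: hom_diff_mx dv dw.
Proof.
apply/row_matrixP => k; rewrite !rowE mulmxDr -scalemxAr !mul_hom_diff_mx addrC -fam_rowP.
apply: eq_fam_row => a; rewrite /hom_diff /rep_line mulmxDr mulmxDl.
by rewrite -scalemxAl -scalemxAr scalerBr opprD addrACA addrC.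
Qed.
End HomExt.

(** * Ranks along a line of matrices *)

Section RankPerturbation.
Variable F : numFieldType.

Lemma poly_nonroot (p : {poly F}) : p != 0 -> exists t, p.[t] != 0.
Proof.
move=> p0; apply: contrapT => nroot.
have rootp t : root p t.
  by apply/rootP/eqP; apply: contrapT => /negP pt; apply: nroot; exists t.
pose s : seq F := [seq i%:R | i <- iota 0 (size p)].
have := @max_poly_roots _ p s p0; rewrite size_map size_iota ltnn; case/(_ _ _)/negP => //.
  by apply/allP => t _; exact: rootp.
by rewrite map_inj_uniq ?iota_uniq // => i j /eqP; rewrite eqr_nat => /eqP.
Qed.

(** [P] and [S] compress [A] to an identity block; the determinant of the same compression of
    [A + t *: B] is a polynomial in [t] with value 1 at 0. *)
Lemma rank_line m n (A B : 'M[F]_(m, n)) :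
  exists2 p : {poly F}, p != 0 &
    forall t, p.[t] != 0 -> (\rank A <= \rank (A + t *: B)%R)%N.
Proof.
have [P PA] : exists P, P *m col_base A = 1%:M.
  by apply/row_fullP; exact: col_base_full.
have [S AS] : exists S, row_base A *m S = 1%:M.
  by apply/row_freeP; exact: row_base_free.
have PAS : P *m A *m S = 1%:M.
  transitivity (P *m (col_base A *m row_base A) *m S); first by rewrite mulmx_base.
  by rewrite (mulmxA P) PA mul1mx AS.
pose M : 'M[{poly F}]_(\rank A) := 1%:M + 'X *: map_mx polyC (P *m B *m S).
have ME t : map_mx (horner_eval t) M = P *m (A + t *: B) *m S.
  rewrite mulmxDr mulmxDl PAS -scalemxAr -scalemxAl.
  by apply/matrixP => i j; rewrite !mxE /horner_eval !hornerE hornerMn hornerC.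
have dM t : (\det M).[t] = \det (P *m (A + t *: B) *m S).
  by rewrite -ME det_map_mx.
exists (\det M) => [|t].
  apply/eqP => M0; have := dM 0; rewrite scale0r addr0 PAS det1 M0 horner0 => /esym/eqP.
  by rewrite oner_eq0.
rewrite dM -unitfE -unitmxE -row_free_unit -row_leq_rank => /leq_trans; apply.
exact: leq_trans (mxrankM_maxl _ _) (mxrankM_maxr _ _).
Qed.

(* Otherwise adjoining [x *m B], with [x *m A = 0], to the row space of [A + t *: B] would
   give too large a space. *)
Lemma rank_max_ker_sub m n (A B : 'M[F]_(m, n)) :
  (forall t, \rank (A + t *: B)%R <= \rank A)%N -> (kermx A *m B <= A)%MS.
Proof.
move=> Amax; set C := kermx A *m B.
have [p p0 pP] := rank_line (col_mx A C) (col_mx B 0).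
have [t] := poly_nonroot (mulf_neq0 p0 (negbT (polyX_eq0 _))).
rewrite hornerM hornerX mulf_eq0 negb_or => /andP[pt t0].
have := pP t pt; rewrite scale_col_mx add_col_mx scaler0 addr0.
have CA : (C <= (A + t *: B)%R)%MS.
  apply/submxP; exists (t^-1 *: kermx A).
  by rewrite mulmxDr -!scalemxAl mulmx_ker scaler0 add0r -scalemxAr scalerA mulVf ?scale1r.
have -> : \rank (col_mx (A + t *: B)%R C) = \rank (A + t *: B)%R.
  by rewrite -addsmxE; apply/eqmx_rank; rewrite addsmxSl addsmx_sub submx_refl CA.
move=> /leq_trans/(_ (Amax t)) le.
have sA : (A <= col_mx A C)%MS by rewrite -addsmxE addsmxSl.
apply: (@submx_trans _ _ _ _ _ _ (col_mx A C)); first by rewrite -addsmxE addsmxSr.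
by rewrite -(geq_leqif (mxrank_leqif_sup sA)).
Qed.
End RankPerturbation.

(** * Generic properties *)

Lemma countable_image (T U : Type) (f : T -> U) (A : set T) :
  countable A -> countable (f @` A)%classic.
Proof. exact/sub_countable/card_image_le. Qed.

Lemma countableU (T : Type) (A B : set T) : countable A -> countable B -> countable (A `|` B)%classic.
Proof.
move=> cA cB; rewrite -bigcup2E; apply: bigcup_countable => [|[|[|i]] _] //=.
Qed.

(** Cantor's nested intervals: each interval is the outer third of the previous one lying across the
    midpoint from [f n], and the supremum of the left ends escapes the enumeration [f]. *)
Lemma uncountable_real (R : realType) : ~ countable [set: R].
Proof.
move=> /countable_injP[e einj].
pose f (n : nat) : R := xget 0 [set x | e x = n].
have fe x : f (e x) = x.
  rewrite /f; case: xgetP => [y _ /= /einj|/(_ x)/(_ erefl)//].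
  by apply; rewrite in_setE.
pose step (n : nat) (I : R * R) := let: (a, b) := I in
  if (a + b) / 2 <= f n then (a, (2 * a + b) / 3) else ((a + 2 * b) / 3, b).
pose J := fix J n := if n is n'.+1 then step n' (J n') else (0, 1).
have JS n : J n.+1 = step n (J n) by [].
have Jlt n : (J n).1 < (J n).2.
  elim: n => [|n]; first exact: ltr01.
  by rewrite JS /step; case: (J n) => a b /= ab; case: ifP => _ /=; lra.
have J1 n : (J n).1 <= (J n.+1).1.
  by have := Jlt n; rewrite JS /step; case: (J n) => a b /= ab; case: ifP => _ /=; lra.
have J2 n : (J n.+1).2 <= (J n).2.
  by have := Jlt n; rewrite JS /step; case: (J n) => a b /= ab; case: ifP => _ /=; lra.
have Jf n : f n < (J n.+1).1 \/ (J n.+1).2 < f n.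
  have := Jlt n; rewrite JS /step; case: (J n) => a b /= ab.
  move: (f n) => y; case: (leP ((a + b) / 2) y) => h /=; [right|left]; lra.
have J1le m n : (m <= n)%N -> (J m).1 <= (J n).1.
  move=> mn; rewrite -(subnK mn); elim: (n - m)%N => [//|k IH].
  by rewrite addSn; apply: le_trans IH (J1 _).
have J2le m n : (m <= n)%N -> (J n).2 <= (J m).2.
  move=> mn; rewrite -(subnK mn); elim: (n - m)%N => [//|k IH].
  by rewrite addSn; apply: le_trans (J2 _) IH.
have J12 m n : (J m).1 <= (J n).2.
  apply: le_trans (J1le _ _ (leq_maxl m n)) _; apply: le_trans (J2le _ _ (leq_maxr m n)).
  exact: ltW.
pose A := [set (J n).1 | n in [set: nat]]%classic; pose s := sup A.
have A0 : (A !=set0)%classic by exists (J 0%N).1; exists 0%N.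
have sle n : s <= (J n).2 by apply: ge_sup => // _ [m _ <-].
have les n : (J n).1 <= s.
  by apply: ub_le_sup; [exists (J 0%N).2 => _ [m _ <-]|exists n].
by have [] := Jf (e s); rewrite fe ltNge ?les ?sle.
Qed.

Section Generic.
Variable F : numClosedFieldType.
Hypothesis Funcountable : ~ countable [set: F].

Lemma exists_notin_countable (A : set F) : countable A -> exists t, ~ A t.
Proof.
move=> cA; apply: contrapT => nA; apply: Funcountable; congr (countable _): cA.
by apply/seteqP; split=> // t _; apply: contrapT => At; apply: nA; exists t.
Qed.

Lemma countable_roots (p : {poly F}) : p != 0 -> countable [set t | p.[t] = 0].
Proof.
move=> p0; have [s sE] := closed_field_poly_normal p.
apply: (@sub_countable _ _ _ [set` s]%classic); last exact/finite_set_countable/finite_seq.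
apply: subset_card_le => t /= /eqP.
rewrite sE hornerZ mulf_eq0 lead_coef_eq0 (negPf p0) /= => ts.
by rewrite -root_prod_XsubC; exact: ts.
Qed.

Lemma countable_subring (E : set {poly F}) : countable E ->
  exists C : set {poly F}, [/\ countable C, (E `<=` C)%classic, C 1,
    forall p q, C p -> C q -> C (p - q) & forall p q, C p -> C q -> C (p * q)].
Proof.
move=> cE; pose next (A : set {poly F}) := (A `|`
  ([set z.1 - z.2 | z in A `*` A] `|` [set z.1 * z.2 | z in A `*` A]))%classic.
pose C_ := fix C_ n := if n is n'.+1 then next (C_ n') else (E `|` [set 1])%classic.
have cC n : countable (C_ n).
  elim: n => [|n IH]; first by apply: countableU => //; exact: countable1.
  by apply: countableU => //; apply: countableU; apply/countable_image/countableX.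
have Cle m n : (m <= n)%N -> (C_ m `<=` C_ n)%classic.
  move=> mn; rewrite -(subnK mn); elim: (n - m)%N => [//|k IH] p /IH.
  by rewrite addSn; left.
exists (\bigcup_n C_ n)%classic; split.
- by apply: bigcup_countable => //; exact: countableP.
- by move=> p Ep; exists 0%N => //; left.
- by exists 0%N => //; right.
- move=> p q [m _ pm] [n _ qn]; exists (maxn m n).+1 => //; right; left.
  by exists (p, q) => //; split; [apply: Cle pm|apply: Cle qn]; rewrite ?leq_maxl ?leq_maxr.
- move=> p q [m _ pm] [n _ qn]; exists (maxn m n).+1 => //; right; right.
  by exists (p, q) => //; split; [apply: Cle pm|apply: Cle qn]; rewrite ?leq_maxl ?leq_maxr.
Qed.

Section Reps.
Variable Q : quiver.

(* For [t] transcendental over the ring generated by the entries of the line, evaluation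
   at [t] can be specialized to evaluation at [0]. *)
Lemma has_subrep_line (n : dimvec Q) (v dv : qrep F n) :
  exists2 A : set F, countable A &
    forall t b, ~ A t -> has_subrep (rep_line v dv t) b -> has_subrep v b.
Proof.
pose T : finType := {a : arrow Q & 'I_(n (source a)) * 'I_(n (target a))}%type.
pose e (z : T) : {poly F} := (v (tag z) (tagged z).1 (tagged z).2)%:P
  + 'X * (dv (tag z) (tagged z).1 (tagged z).2)%:P.
have [|C [cC EC C1 CB CM]] := @countable_subring (range e).
  exact/countable_image/countableP.
(* Off this set a polynomial of [C] is determined by its value at [t], so that [p.[t]] can be sent
   to [p.[0]]. *)
exists (\bigcup_(p in [set p | C p /\ p != 0]) [set t | p.[t] = 0])%classic.
  apply: bigcup_countable => [|p [_ p0]]; last exact: countable_roots.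
  by apply: sub_countable cC; apply: subset_card_le => p [].
move=> t b nt; pose G := [set (p.[t], p.[0]) | p in C]%classic.
apply: (@has_subrep_specialize _ _ G).
  split.
  - by exists 1 => //; rewrite !hornerC.
  - by move=> _ _ [p Cp <-] [q Cq <-]; exists (p - q); [exact: CB|rewrite !hornerD !hornerN].
  - by move=> _ _ [p Cp <-] [q Cq <-]; exists (p * q); [exact: CM|rewrite !hornerM].
  - move=> y [p Cp [pt <-]]; have [->|p0] := eqVneq p 0; first by rewrite horner0.
    by case: nt; exists p.
move=> a i j; exists (e (existT _ a (i, j))); first by apply: EC; exists (existT _ a (i, j)).
by rewrite /e /rep_line !mxE !hornerE ?mul0r ?addr0.
Qed.

Section GenericProperties.
Variables al ga : dimvec Q.
Implicit Types (P : qrep F al -> qrep F ga -> Prop).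

(* Stands for Zariski open: it only tests lines, up to countably many points. *)
Definition generic P := forall v w dv dw, P v w ->
  exists2 A : set F, countable A & forall t, ~ A t -> P (rep_line v dv t) (rep_line w dw t).

Lemma generic_and P P' : generic P -> generic P' -> generic (fun v w => P v w /\ P' v w).
Proof.
move=> gP gP' v w dv dw [/(gP _ _ dv dw)[A cA AP] /(gP' _ _ dv dw)[A' cA' AP']].
exists (A `|` A')%classic; first exact: countableU.
by move=> t At; split; [apply: AP|apply: AP'] => ?; apply: At; [left|right].
Qed.

(** On the line joining a witness of [P] to a witness of [P'], both properties hold off countable
    sets; the parameter seen from the other end is [1 - t]. *)
Lemma generic_meet P P' : generic P -> generic P' ->
  (exists v w, P v w) -> (exists v w, P' v w) -> exists v w, P v w /\ P' v w.
Proof.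
move=> gP gP' [v [w /gP vwP]] [v' [w' /gP' vwP']].
pose d (n : dimvec Q) (u u' : qrep F n) : qrep F n := fun a => u' a - u a.
have [A cA AP] := vwP (d _ v v') (d _ w w').
have [A' cA' AP'] := vwP' (d _ v' v) (d _ w' w).
have [t At] := exists_notin_countable
  (countableU cA (countable_image (fun t => 1 - t) cA')).
have lineE (n : dimvec Q) (u u' : qrep F n) : rep_line u' (d _ u' u) (1 - t) = rep_line u (d _ u u') t.
  apply: functional_extensionality_dep => a; apply/matrixP => i j.
  by rewrite /rep_line /d !mxE; ring.
exists (rep_line v (d _ v v') t), (rep_line w (d _ w w') t); split.
  by apply: AP => ?; apply: At; left.
rewrite -!lineE; apply: AP' => At'; apply: At; right; exists (1 - t) => //.
by rewrite opprB addrCA subrr addr0.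
Qed.

Lemma generic_all (I : finType) (P : I -> qrep F al -> qrep F ga -> Prop) :
  (forall i, generic (P i)) -> (forall i, exists v w, P i v w) ->
  generic (fun v w => forall i, P i v w) /\ exists v w, forall i, P i v w.
Proof.
move=> gP exP.
suff : forall s : seq I, generic (fun v w => forall i, i \in s -> P i v w) /\
    exists v w, forall i, i \in s -> P i v w.
  move=> /(_ (enum I))[gs [v [w vwP]]]; split; last first.
    by exists v, w => i; apply: vwP; rewrite mem_enum.
  move=> v' w' dv dw vwP'; have [//|A cA AP] := gs v' w' dv dw.
  by exists A => // t At i; apply: AP; rewrite ?mem_enum.
elim=> [|i s [gs exs]].
  by split; [move=> v w dv dw _; exists set0; [exact: countable0|]|exists (fun=> 0), (fun=> 0)].
split.
  move=> v w dv dw vwP; have [|A cA AP] := generic_and (gP i) gs (v := v) (w := w) dv dw.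
    by split=> [|j js]; apply: vwP; rewrite inE ?eqxx // js orbT.
  by exists A => // t At j /predU1P[->|js]; have [Pi Ps] := AP t At; [|apply: Ps].
have [v [w [Pi Ps]]] := generic_meet (gP i) gs (exP i) exs.
by exists v, w => j /predU1P[->|/Ps].
Qed.

Lemma generic_rank r :
  generic (fun v w => r <= \rank (hom_diff_mx v w))%N.
Proof.
move=> v w dv dw rvw; have [p p0 pP] := rank_line (hom_diff_mx v w) (hom_diff_mx dv dw).
exists [set t | p.[t] = 0]%classic; first exact: countable_roots.
move=> t /eqP pt; rewrite hom_diff_mx_line; exact: leq_trans rvw (pP t pt).
Qed.

Lemma generic_ext0 (b : dimvec Q) (u : qrep F b) :
  generic (fun _ w => row_full (hom_diff_mx u w)).
Proof.
move=> v w dv dw uw.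
have [p p0 pP] := rank_line (hom_diff_mx u w) (hom_diff_mx (fun=> 0) dw).
exists [set t | p.[t] = 0]%classic; first exact: countable_roots.
move=> t /eqP/pP; rewrite -hom_diff_mx_line -!col_leq_rank in uw *.
rewrite (_ : rep_line u _ t = u); first exact: leq_trans.
by apply: functional_extensionality_dep => a; rewrite /rep_line scaler0 addr0.
Qed.

(** The implication form makes the property attainable for every [b]: it is automatic when [b] is a
    generic subdimension vector, and otherwise says that [v] has no subrepresentation of dimension
    [b]. *)
Lemma generic_no_subrep (b : dimvec Q) :
  generic (fun v _ => has_subrep v b -> gen_subrep F b al).
Proof.
move=> v w dv dw vb; have [A cA AP] := has_subrep_line v dv.
by exists A => // t At /(AP t b At)/vb.
Qed.
End GenericProperties.
End Reps.
End Generic.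

(** * Trace pairing and a dual criterion for the vanishing of Ext *)

Section Pairing.
Variables (F : fieldType) (I : finType) (m n : I -> nat).

Lemma fam_row_pairing (A B : forall i, 'M[F]_(m i, n i)) :
  (fam_row A *m (fam_row B)^T) 0 0 = \sum_i \tr (A i *m (B i)^T).
Proof.
rewrite mxE (reindex_onto enum_rank enum_val) /= => [|k _]; last by rewrite enum_valK.
rewrite (eq_bigl predT) => [|z]; last by rewrite enum_rankK eqxx.
rewrite (eq_bigr (fun z => A (tag z) (tagged z).1 (tagged z).2
    * B (tag z) (tagged z).1 (tagged z).2)) => [|z _]; last by rewrite !mxE enum_rankK.
rewrite -(sig_big_dep predT (fun _ => predT)
  (fun i (z : 'I_(m i) * 'I_(n i)) => A i z.1 z.2 * B i z.1 z.2)) /=.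
apply: eq_bigr => i _; rewrite -(pair_bigA _ (fun p q => A i p q * B i p q)) /=.
by apply: eq_bigr => p _; rewrite mxE; apply: eq_bigr => q _; rewrite mxE.
Qed.

Lemma fam_pairing_eq0 (B : forall i, 'M[F]_(n i, m i)) :
  (forall A : forall i, 'M[F]_(m i, n i), \sum_i \tr (A i *m B i) = 0) ->
  forall i, B i = 0.
Proof.
move=> AB0 i; pose Bt i := (B i)^T.
suff Bt0 : fam_row Bt = 0.
  by rewrite -[B i]trmxK -[(B i)^T]/(Bt i) -(fam_rowK Bt) Bt0 row_fam0 trmx0.
apply: trmx_inj; apply/colP => k; rewrite trmx0 [RHS]mxE.
have := AB0 (row_fam (delta_mx 0 k)).
under eq_bigr do rewrite -[B _]trmxK.
by rewrite -(fam_row_pairing _ Bt) row_famK -rowE mxE.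
Qed.
End Pairing.

Section Schofield.
Variables (F : fieldType) (Q : quiver).

Lemma has_subrep_leq (n b : dimvec Q) (v : qrep F n) : has_subrep v b -> dimvec_le b n.
Proof.
by case=> S [Sfree _] x; rewrite -(eqP (Sfree x)) rank_leq_col.
Qed.

Lemma gen_subrep_refl (n : dimvec Q) : gen_subrep F n n.
Proof.
split=> [x|v]; first exact: leqnn.
exists (fun=> 1%:M); split=> [x|]; first by rewrite row_free_unit unitmx1.
by exists v => a; rewrite mul1mx mulmx1.
Qed.

Lemma gen_subrep_trans (b al n : dimvec Q) :
  gen_subrep F b al -> gen_subrep F al n -> gen_subrep F b n.
Proof.
move=> [bal b_al] [aln al_n]; split=> [x|v]; first exact: leq_trans (bal x) (aln x).
have [S [Sfree [X SX]]] := al_n v; have [T [Tfree [Y TY]]] := b_al X.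
exists (fun x => T x *m S x); split.
  by move=> x; rewrite /row_free mxrankMfree //; exact: Tfree.
by exists Y => a; rewrite -mulmxA SX !mulmxA TY.
Qed.

Lemma row_full_cokermx m n (A : 'M[F]_(m, n)) :
  (forall c : 'cV[F]_n, A *m c = 0 -> c = 0) -> row_full A.
Proof.
move=> A0; rewrite -col_leq_rank -mxrank_tr row_leq_rank -kermx_eq0.
apply/eqP/row_matrixP => i; rewrite row0; apply: trmx_inj; rewrite trmx0.
apply: A0; apply: trmx_inj; rewrite trmx_mul trmxK trmx0 -row_mul mulmx_ker.
by rewrite row0.
Qed.

Section Extension.
Variables (al ga b : dimvec Q) (v : qrep F al) (w : qrep F ga) (X : qrep F b).
Variable B : forall x, 'M[F]_(b x, al x).
Hypothesis Bfree : forall x, row_free (B x).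
Hypothesis BX : forall a, B (source a) *m v a = X a *m B (target a).

(* A linear form on the target of [hom_diff v w] that vanishes on the image kills the
   products [phi dw], hence it factors through the restriction of maps to the
   subrepresentation [X], where it vanishes since [Ext(X, w) = 0]. *)
Lemma hom_diff_full_of_subrep k
    (K : 'M[F]_(k, #|{: {x : vertex Q & 'I_(al x) * 'I_(ga x)}}|)) :
  row_full (hom_diff_mx X w) ->
  (forall dw, (K *m hom_diff_mx (fun=> 0) dw <= hom_diff_mx v w)%MS) ->
  (forall x m (u : 'M[F]_(m, al x)), (forall i, u *m row_fam (row i K) x = 0) ->
     (u <= B x)%MS) ->
  row_full (hom_diff_mx v w).
Proof.
move=> /hom_diff_mxP Xw Kdw Kker; apply: row_full_cokermx => c Dc.
pose M := row_fam c^T.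
have cE : c = (fam_row M)^T by rewrite row_famK trmxK.
have MK i a : (M a)^T *m row_fam (row i K) (source a) = 0.
  move: a; apply: fam_pairing_eq0 => dw.
  have /submxP[Z ZE] := Kdw dw.
  have E0 : (row i K *m hom_diff_mx (fun=> 0) dw *m c) 0 0 = 0.
    by rewrite -row_mul ZE -row_mul -mulmxA Dc mulmx0 !mxE.
  move: E0; rewrite mul_hom_diff_mx {1}cE fam_row_pairing => E0.
  rewrite -[RHS]E0; apply: eq_bigr => a _.
  by rewrite /hom_diff mul0mx subr0 mulmxA mxtrace_mulC mulmxA.
have [Z ZE] : exists Z : forall a, 'M[F]_(ga (target a), b (source a)),
    forall a, (M a)^T = Z a *m B (source a).
  apply: (@dependent_choice _ (fun a => 'M[F]_(ga (target a), b (source a)))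
    (fun a Z => (M a)^T = Z *m B (source a))) => a.
  by apply/submxP; apply: Kker => i; exact: MK.
have Z0 : forall a, Z a = 0.
  apply: fam_pairing_eq0 => chi; have [psi psiE] := Xw chi.
  have [P PE] : exists P : forall x, 'M[F]_(al x, b x), forall x, B x *m P x = 1%:M.
    apply: (@dependent_choice _ (fun x => 'M[F]_(al x, b x))
      (fun x P => B x *m P = 1%:M)) => x.
    exact/row_freeP.
  (* This extends [psi] from the subrepresentation: [B x *m phi x = psi x]. *)
  pose phi x := P x *m psi x.
  have E0 : (fam_row phi *m hom_diff_mx v w *m c) 0 0 = 0.
    by rewrite -mulmxA Dc mulmx0 mxE.
  move: E0; rewrite mul_hom_diff_mx {1}cE fam_row_pairing => E0.
  rewrite -[RHS]E0; apply: eq_bigr => a _.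
  rewrite ZE mulmxA [RHS]mxtrace_mulC mulmxA -psiE; congr (\tr (_ *m _)).
  rewrite /hom_diff !fam_rowK /phi mulmxBr !mulmxA PE mul1mx BX -!mulmxA.
  by rewrite (mulmxA (B _)) PE mul1mx.
apply: trmx_inj; rewrite trmx0 -[c^T]row_famK -/M (_ : fam_row M = fam_row (fun=> 0)).
  by apply/rowP => k'; rewrite !mxE.
by apply: eq_fam_row => a; apply: trmx_inj; rewrite ZE Z0 mul0mx trmx0.
Qed.
End Extension.
End Schofield.

Lemma exists_maximizer (T : Type) (f : T -> nat) (N : nat) (t0 : T) :
  (forall t, f t <= N)%N -> exists t, forall t', (f t' <= f t)%N.
Proof.
move=> fN; have [||r /asboolP[t <-] rmax] := @ex_maxnP (fun r => `[< exists t, f t = r >]) N.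
- by exists (f t0); apply/asboolP; exists t0.
- by move=> r /asboolP[t <-].
- by exists t => t'; apply: rmax; apply/asboolP; exists t'.
Qed.

Lemma exists_minimizer (T : Type) (P : T -> Prop) (f : T -> nat) :
  (exists t, P t) -> exists2 t, P t & forall t', P t' -> (f t <= f t')%N.
Proof.
move=> [t0 Pt0]; have [|r /asboolP[t Pt <-] rmin] :=
  @ex_minnP (fun r => `[< exists2 t, P t & f t = r >]).
  by exists (f t0); apply/asboolP; exists t0.
by exists t => // t' Pt'; apply: rmin; apply/asboolP; exists t'.
Qed.

(** * Vanishing of Ext for a generic pair *)

Section Closed.
Variable F : numClosedFieldType.
Hypothesis Funcountable : ~ countable [set: F].
Variable Q : quiver.

(** A finite type reaching every [b <= n], so that only finitely many generic conditions have to be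
    met; the sum is a crude bound common to all vertices. *)
Definition bounded_dimvec (n : dimvec Q) := {ffun vertex Q -> 'I_(\sum_x n x).+1}.

Definition dimvec_of (n : dimvec Q) (b : bounded_dimvec n) : dimvec Q := fun x => b x.

Lemma dimvec_ofP (n b : dimvec Q) : dimvec_le b n -> exists b', b = @dimvec_of n b'.
Proof.
move=> bn; exists [ffun x => inord (b x)]; apply: functional_extensionality_dep => x.
rewrite /dimvec_of ffunE inordK // ltnS (leq_trans (bn x)) //.
by rewrite (bigD1 x) //= leq_addr.
Qed.

(** A subrepresentation constructed inside this single [v] gives a statement about all
    representations of dimension [al]. *)
Lemma exists_generic_rep (al : dimvec Q) :
  exists v : qrep F al, forall b, has_subrep v b -> gen_subrep F b al.
Proof.
have [|b|_ [v [_ vP]]] := @generic_all F Funcountable Q al al (bounded_dimvec al)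
  (fun b v _ => has_subrep v (dimvec_of b) -> gen_subrep F (dimvec_of b) al).
- by move=> b; apply: generic_no_subrep.
- have [vb|] := pselect (gen_subrep F (dimvec_of b) al).
    by exists (fun=> 0), (fun=> 0).
  have [ble nvb|nble _] := pselect (dimvec_le (dimvec_of b) al); last first.
    by exists (fun=> 0), (fun=> 0) => /has_subrep_leq.
  have [v vb] : exists v : qrep F al, ~ has_subrep v (dimvec_of b).
    apply: contrapT => nv; apply: nvb; split=> // v; apply: contrapT => vb.
    by apply: nv; exists v.
  by exists v, (fun=> 0) => /vb.
- exists v => b vb; have [b' bE] := dimvec_ofP (has_subrep_leq vb).
  by move: vb; rewrite bE; exact: vP.
Qed.

Variable ga : dimvec Q.

(** The inequality is [<b, ga> >= 0] with the arrow term moved across, to stay in [nat]. *)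
Definition stable (al : dimvec Q) := forall b, gen_subrep F b al ->
  (\sum_a b (source a) * ga (target a) <= \sum_x b x * ga x)%N.

(* Let [N] be the common kernel of [Hom(v, w)] for a generic pair. Replacing [N] by a
   generic representation [k] of the same dimension changes neither [Hom(v, w)] nor the
   rank of [hom_diff_mx], while [Ext(k, w) = 0] by induction; then [Ext(v, w) = 0]. *)
Lemma stable_ext0 (al : dimvec Q) : stable al ->
  exists (v : qrep F al) (w : qrep F ga), row_full (hom_diff_mx v w).
Proof.
have [N] := ubnP (\sum_x al x)%N; elim: N => // N IH in al *.
rewrite ltnS => alN al_stable.
pose rk (p : qrep F al * qrep F ga) := \rank (hom_diff_mx p.1 p.2).
have [[v0 w0] rmax] := @exists_maximizer _ rk _ (fun=> 0, fun=> 0) (fun p => rank_leq_col _).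
pose proper (b : dimvec Q) := gen_subrep F b al /\ exists x, b x <> al x.
have ext0_proper b : proper b -> exists (k : qrep F b) (w : qrep F ga), row_full (hom_diff_mx k w).
  move=> [bal [x bx]]; apply: IH.
    apply: leq_trans alN; rewrite (bigD1 x) //= [X in (_ < X)%N](bigD1 x) //= -addSn.
    apply: leq_add; last by apply: leq_sum => y _; case: bal.
    by rewrite ltn_neqAle (proj1 bal x) andbT; apply/eqP.
  by move=> c cb; apply: al_stable; exact: gen_subrep_trans cb bal.
pose P1 (b : bounded_dimvec al) (v : qrep F al) (w : qrep F ga) :=
  has_subrep v (dimvec_of b) -> gen_subrep F (dimvec_of b) al.
pose P2 (b : bounded_dimvec al) (v : qrep F al) (w : qrep F ga) :=
  proper (dimvec_of b) -> exists k : qrep F (dimvec_of b), row_full (hom_diff_mx k w).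
have [gP1 exP1] : generic (fun v w => forall b, P1 b v w) /\
    exists v w, forall b, P1 b v w.
  apply: generic_all => // b; first exact: generic_no_subrep.
  have [v vP] := exists_generic_rep al.
  by exists v, (fun=> 0) => /vP.
have [gP2 exP2] : generic (fun v w => forall b, P2 b v w) /\
    exists v w, forall b, P2 b v w.
  apply: generic_all => // b.
    move=> v w dv dw vw; have [pb|npb] := pselect (proper (dimvec_of b)); last first.
      by exists set0 => [|t _ /npb]; first exact: countable0.
    have [k kw] := vw pb; have [A cA AP] := @generic_ext0 F Q al ga _ k v w dv dw kw.
    by exists A => // t At _; exists k; apply: AP.
  have [/ext0_proper[k [w kw]]|npb] := pselect (proper (dimvec_of b)).
    by exists (fun=> 0), w => _; exists k.
  by exists (fun=> 0), (fun=> 0).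
have exP12 := generic_meet Funcountable gP1 gP2 exP1 exP2.
have [v [w [[vw1 vw2] vwr]]] := generic_meet Funcountable (generic_and gP1 gP2)
  (@generic_rank _ _ _ _ (rk (v0, w0))) exP12 (ex_intro _ v0 (ex_intro _ w0 (leqnn _))).
have rkmax (v' : qrep F al) (w' : qrep F ga) : (\rank (hom_diff_mx v' w') <= \rank (hom_diff_mx v w))%N.
  exact: leq_trans (rmax (v', w')) vwr.
pose K := kermx (hom_diff_mx v w).
pose Nx x := (\bigcap_k kermx (row_fam (row k K) x))%MS.
pose b : dimvec Q := fun x => \rank (Nx x).
have [B [BN Bfree]] : exists B : forall x, 'M[F]_(b x, al x),
    (forall x, (B x :=: Nx x)%MS) /\ forall x, row_free (B x).
  exists (fun x => row_base (Nx x)).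
  by split=> x; [exact: eq_row_base|exact: row_base_free].
have NP x m (u : 'M[F]_(m, al x)) :
    (forall k, u *m row_fam (row k K) x = 0) <-> (u <= B x)%MS.
  rewrite BN; split=> [uK|/sub_bigcapmxP uN k]; last by apply/sub_kermxP/uN.
  by apply/sub_bigcapmxP => k _; apply/sub_kermxP.
have Kker k a : row_fam (row k K) (source a) *m w a = v a *m row_fam (row k K) (target a).
  have : row k K *m hom_diff_mx v w = 0 by rewrite -row_mul mulmx_ker row0.
  rewrite mul_hom_diff_mx => /(congr1 (fun u => row_fam u a)).
  by rewrite fam_rowK row_fam0 => /subr0_eq.
have [X XE] : exists X : qrep F b, forall a, B (source a) *m v a = X a *m B (target a).
  apply: (@dependent_choice _ (fun a => 'M[F]_(b (source a), b (target a)))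
    (fun a X => B (source a) *m v a = X *m B (target a))) => a.
  apply/submxP/NP => k; rewrite -mulmxA -Kker mulmxA.
  by rewrite (proj2 (NP _ _ _) (submx_refl _)) mul0mx.
have vb : has_subrep v b by exists B; split=> //; exists X.
have [b' bE] := dimvec_ofP (has_subrep_leq vb).
have bal : gen_subrep F b al by rewrite bE; apply: vw1; rewrite -bE.
(* If the common kernel is everything, then [Hom(v, w) = 0]: the differential is injective, and
   stability at [al] itself makes it surjective by dimension. *)
have [ball|/existsNP[x bx]] := pselect (forall x, b x = al x).
  exists v, w; suff K0 : K = 0.
    rewrite -col_leq_rank.
    have -> : \rank (hom_diff_mx v w) = (\sum_x al x * ga x)%N.
      by rewrite -card_fam; apply/eqP; rewrite -/(row_free _) -kermx_eq0 -/K K0.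
    by rewrite card_fam; apply: al_stable; exact: gen_subrep_refl.
  apply/row_matrixP => k; rewrite row0 -[row k K]row_famK -[RHS]row_famK.
  apply: eq_fam_row => x; rewrite row_fam0 -[LHS]mul1mx.
  move: k; apply/NP; apply: submx_full.
  by rewrite /row_full (eqP (Bfree x)) ball.
have [|k kw] := vw2 b'; first by rewrite -bE; split=> //; exists x.
move: k kw; rewrite -bE => k kw.
have [P PE] : exists P : forall x, 'M[F]_(al x, b x), forall x, B x *m P x = 1%:M.
  apply: (@dependent_choice _ (fun x => 'M[F]_(al x, b x))
    (fun x P => B x *m P = 1%:M)) => x'.
  exact/row_freeP.
(* Deform [v] by moving its subrepresentation [X] towards [k]; this does not affect the
   morphisms to [w], which all kill [X]. *)
pose dv a := P (source a) *m (k a - X a) *m B (target a).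
pose dX a := k a - X a.
(* The rank is maximal at [t = 0], where the representation is [v], and Ext of the subrepresentation
   vanishes at [t = 1], where it is [k]. Each condition persists off a countable set, so some [t]
   satisfies both. *)
have [p p0 pP] := rank_line (hom_diff_mx v w) (hom_diff_mx dv (fun=> 0)).
have [q q0 qP] := rank_line (hom_diff_mx k w) (hom_diff_mx (fun a => - dX a) (fun=> 0)).
have [t tP] := exists_notin_countable Funcountable (countableU (countable_roots p0)
  (countable_image (fun t => 1 - t) (countable_roots q0))).
have w0E s : rep_line w (fun=> 0) s = w.
  by apply: functional_extensionality_dep => a; rewrite /rep_line scaler0 addr0.
have rkt : (\rank (hom_diff_mx v w) <= \rank (hom_diff_mx (rep_line v dv t) w))%N.
  rewrite -{2}(w0E t) hom_diff_mx_line; apply: pP; apply/eqP => pt.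
  by apply: tP; left.
have Xt : row_full (hom_diff_mx (rep_line X dX t) w).
  have -> : rep_line X dX t = rep_line k (fun a => - dX a) (1 - t).
    apply: functional_extensionality_dep => a; apply/matrixP => i j.
    by rewrite /rep_line /dX !mxE; ring.
  rewrite -{1}(w0E (1 - t)) hom_diff_mx_line -col_leq_rank.
  rewrite -col_leq_rank in kw; apply: leq_trans kw (qP _ _); apply/eqP => qt.
  by apply: tP; right; exists (1 - t) => //; rewrite opprB addrCA subrr addr0.
exists (rep_line v dv t), w.
apply: (@hom_diff_full_of_subrep _ _ _ _ _ _ _ (rep_line X dX t) B _ _ _ K) => //.
- move=> a; rewrite /rep_line mulmxDr mulmxDl XE -scalemxAr -scalemxAl.
  by rewrite /dv !mulmxA PE mul1mx.
- move=> dw; have KD : K *m hom_diff_mx (rep_line v dv t) w = 0.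
    apply/row_matrixP => i; rewrite row0 row_mul mul_hom_diff_mx -[RHS]row_famK.
    apply: eq_fam_row => a; rewrite row_fam0 /hom_diff /rep_line mulmxDl -scalemxAl.
    rewrite /dv -!mulmxA (proj2 (NP _ _ _) (submx_refl _)) !mulmx0 scaler0 addr0.
    by rewrite Kker subrr.
  have /sub_kermxP/submxMr := KD; move/(_ _ (hom_diff_mx (fun=> 0) dw))/submx_trans; apply.
  apply: rank_max_ker_sub => s; rewrite -hom_diff_mx_line.
  exact: leq_trans (rkmax _ _) rkt.
- by move=> x' m u uK; apply/NP.
Qed.
End Closed.

(** * Stability *)

Section SubrepLattice.
Variables (F : fieldType) (Q : quiver) (al : dimvec Q) (v : qrep F al).

Lemma has_subrep_spaces (p b : dimvec Q) (N : forall x, 'M[F]_(p x, al x)) :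
  (forall a, (N (source a) *m v a <= N (target a))%MS) ->
  (forall x, \rank (N x) = b x) -> has_subrep v b.
Proof.
move=> Nv Nb.
have [B BP] : exists B : forall x, 'M[F]_(b x, al x),
    forall x, row_free (B x) /\ (B x :=: N x)%MS.
  apply: (@dependent_choice _ (fun x => 'M[F]_(b x, al x))
    (fun x B => row_free B /\ (B :=: N x)%MS)) => x.
  by rewrite -(Nb x); exists (row_base (N x)); split; [exact: row_base_free|exact: eq_row_base].
exists B; split; first by move=> x; case: (BP x).
apply: (@dependent_choice _ (fun a => 'M[F]_(b (source a), b (target a)))
  (fun a X => B (source a) *m v a = X *m B (target a))) => a.
apply/submxP; have [_ Bs] := BP (source a); have [_ Bt] := BP (target a).
by rewrite Bt (eqmxMr _ Bs).
Qed.

Lemma row_free_complement r n (S : 'M[F]_(r, n)) : row_free S ->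
  exists (T : 'M[F]_(n - r, n)) (U : 'M[F]_(n, r)) (V : 'M[F]_(n, n - r)),
    [/\ S *m U = 1%:M, S *m V = 0, T *m V = 1%:M, T *m U = 0 & U *m S + V *m T = 1%:M].
Proof.
move=> Sfree; have [U SU] := row_freeP Sfree.
have rU : \rank U = r.
  apply/eqP; rewrite eqn_leq rank_leq_col -[X in (X <= _)%N](mxrank1 F r) -SU.
  exact: mxrankM_maxr.
have [T [Tfree TK]] : exists T : 'M[F]_(n - r, n), row_free T /\ (T :=: kermx U)%MS.
  have <- : \rank (kermx U) = (n - r)%N by rewrite mxrank_ker rU.
  exists (row_base (kermx U)).
  by split; [exact: row_base_free|exact: eq_row_base].
have TU : T *m U = 0 by apply/sub_kermxP; rewrite TK.
have /submxP[V VT] : (1%:M - U *m S <= T)%MS.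
  by rewrite TK; apply/sub_kermxP; rewrite mulmxBl mul1mx -mulmxA SU mulmx1 subrr.
exists T, U, V; split=> //.
- apply: (row_free_inj Tfree); rewrite /= mul0mx -mulmxA -VT mulmxBr mulmx1 mulmxA.
  by rewrite SU mul1mx subrr.
- apply: (row_free_inj Tfree); rewrite /= mul1mx -mulmxA -VT mulmxBr mulmx1 mulmxA.
  by rewrite TU mul0mx subr0.
- by rewrite -VT addrC subrK.
Qed.

(* [rho] is the rank of a nonzero morphism from the subrepresentation to the quotient,
   whose kernel and image provide the other two subrepresentations. *)
Lemma has_subrep_quotient (b : dimvec Q) : has_subrep v b ->
  (\sum_x b x * (al x - b x) <=
   \sum_a b (source a) * (al (target a) - b (target a)))%N \/
  exists rho : dimvec Q, [/\ exists x, rho x <> 0%N, dimvec_le rho b,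
    has_subrep v (fun x => b x - rho x)%N & has_subrep v (fun x => b x + rho x)%N].
Proof.
move=> [S [Sfree [X SX]]].
have [T TP] := dependent_choice (fun x => row_free_complement (Sfree x)).
have [U UP] := dependent_choice TP; have [V VP] := dependent_choice UP.
pose c : dimvec Q := fun x => (al x - b x)%N.
pose Y : qrep F c := fun a => T (source a) *m v a *m V (target a).
(* [Y] is the quotient by [X]. If there is no nonzero morphism, the dimensions of source and target
   of the injective differential give the first alternative. *)
have [Dfree|] := boolP (row_free (hom_diff_mx X Y)).
  left; rewrite -(card_fam b c) -(eqP Dfree).
  by rewrite -(card_fam (fun a => b (source a)) (fun a => c (target a))) rank_leq_col.
rewrite -kermx_eq0 => /rowV0Pn[u /sub_kermxP uD u0]; right.
pose phi x := row_fam u x; pose rho x := \rank (phi x).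
have phiE a : phi (source a) *m Y a = X a *m phi (target a).
  move: uD; rewrite mul_hom_diff_mx => /(congr1 (fun u => row_fam u a)).
  by rewrite fam_rowK row_fam0 => /subr0_eq.
have TvE a : T (source a) *m v a =
    T (source a) *m v a *m U (target a) *m S (target a) + Y a *m T (target a).
  have [_ _ _ _ UV] := VP (target a).
  by rewrite -[LHS]mulmx1 -UV mulmxDr !mulmxA.
exists rho; split.
- apply: contrapT => rho0; case/eqP: u0; rewrite -[u]row_famK -[RHS]row_famK.
  apply: eq_fam_row => x; rewrite row_fam0; apply/eqP; rewrite -mxrank_eq0.
  by apply/eqP; apply: contrapT => rx; apply: rho0; exists x.
- by move=> x; exact: rank_leq_row.
- apply: (@has_subrep_spaces b _ (fun x => kermx (phi x) *m S x)) => [a|x].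
    rewrite -mulmxA SX mulmxA submxMr //; apply/sub_kermxP.
    by rewrite -mulmxA -phiE mulmxA mulmx_ker mul0mx.
  by rewrite mxrankMfree // mxrank_ker.
(* This is the preimage in [v] of the image of [phi], which the complement [T] lifts from the
   quotient. *)
apply: (@has_subrep_spaces (fun x => b x + b x)%N _
    (fun x => col_mx (S x) (phi x *m T x))) => [a|x].
  rewrite mul_col_mx col_mx_sub; apply/andP; split.
    by rewrite SX -addsmxE (submx_trans (submxMl _ _)) // addsmxSl.
  rewrite -mulmxA TvE mulmxDr (mulmxA _ (Y a)) phiE -(mulmxA (X a)) -addsmxE.
  by rewrite addmx_sub_adds ?submxMl // mulmxA submxMl.
have [SU SV TV TU _] := VP x.
have -> : col_mx (S x) (phi x *m T x) = block_mx 1%:M 0 0 (phi x) *m col_mx (S x) (T x).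
  by rewrite mul_block_col !mul0mx mul1mx addr0 add0r.
rewrite mxrankMfree; first by rewrite rank_diag_block_mx mxrank1.
apply/row_freeP; exists (row_mx (U x) (V x)).
by rewrite mul_col_row SU SV TU TV -scalar_mx_block.
Qed.
End SubrepLattice.

Section Stability.
Variable F : numClosedFieldType.
Hypothesis Funcountable : ~ countable [set: F].
Variables (Q : quiver) (al n : dimvec Q).
Hypothesis aln : dimvec_le al n.
Let ga : dimvec Q := fun x => (n x - al x)%N.

Let slope (b : dimvec Q) : int :=
  (\sum_x b x * ga x)%N%:Z - (\sum_a b (source a) * ga (target a))%N%:Z.

(* A generic subdimension vector [b] minimizing [slope], and of minimal size among those,
   has no nonzero morphism to the quotient, hence [<b, al - b> <= 0]; then
   [slope b = <b, n - b> - <b, al - b>] is nonnegative. *)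
Lemma stable_of_gen_subrep :
  (\sum_a al (source a) * ga (target a) <= \sum_x al x * ga x)%N ->
  (forall b, gen_subrep F b al -> (exists x, (b x < al x)%N) -> gen_subrep F b n) ->
  stable F ga al.
Proof.
move=> A B b0 b0al; rewrite leqNgt; apply/negP => b0neg.
(* Shifting by [M] makes the slope nonnegative on all [b <= al], so that a minimum can be taken in
   [nat]. *)
pose M := (\sum_a al (source a) * ga (target a))%N.
have slopeM b : dimvec_le b al -> 0 <= slope b + M%:Z.
  move=> bal; rewrite /slope -addrA addr_ge0 // addrC subr_ge0 lez_nat.
  by apply: leq_sum => a _; rewrite leq_mul2r bal orbT.
pose f b := `|(slope b + M%:Z)%R|%N.
have fE b : dimvec_le b al -> (f b)%:Z = slope b + M%:Z by move=> /slopeM/gez0_abs.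
have [b1 b1al b1min] := exists_minimizer f (ex_intro (fun b => gen_subrep F b al) b0 b0al).
have [b [bal bmin] bsize] := exists_minimizer (fun b : dimvec Q => \sum_x b x)%N
  (ex_intro (fun b => gen_subrep F b al /\
     forall b', gen_subrep F b' al -> (f b <= f b')%N) b1 (conj b1al b1min)).
have bneg : slope b < 0.
  have := bmin b0 b0al; rewrite -lez_nat (fE b (proj1 bal)) (fE b0 (proj1 b0al)) lerD2r.
  by move/le_lt_trans; apply; rewrite /slope subr_lt0 ltz_nat.
have [v vP] := exists_generic_rep Funcountable al.
have [ext|[rho [[x rx] rhob ker im]]] := has_subrep_quotient (proj2 bal v); last first.
  (* Neither slope is below the minimum and their sum is twice the minimum, so the kernel is a
     minimizer too; it is strictly smaller than [b]. *)
  have slopeD : slope (fun x => b x - rho x)%N + slope (fun x => b x + rho x)%N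
      = slope b + slope b.
    have sumD (I : finType) (s t : I -> vertex Q) :
        (\sum_i (b (s i) - rho (s i)) * ga (t i) + \sum_i (b (s i) + rho (s i)) * ga (t i)
         = \sum_i b (s i) * ga (t i) + \sum_i b (s i) * ga (t i))%N.
      rewrite -!big_split; apply: eq_bigr => i _ /=.
      by have := rhob (s i); nia.
    have := sumD _ id id; have := sumD _ (@source Q) (@target Q).
    by rewrite /slope /=; lia.
  have kerle := bmin _ (vP _ ker); have imle := bmin _ (vP _ im).
  have fker : (f (fun x => b x - rho x) = f b)%N.
    apply/eqP; rewrite eqn_leq kerle andbT.
    move: imle slopeD; rewrite -!lez_nat (fE _ (proj1 bal)) (fE _ (proj1 (vP _ ker))).
    by rewrite (fE _ (proj1 (vP _ im))); lia.
  have := bsize (fun x => b x - rho x)%N (conj (vP _ ker) _).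
  rewrite fker => /(_ bmin); apply/negP; rewrite -ltnNge.
  rewrite (bigD1 x) //= [X in (_ < X)%N](bigD1 x) //= -addSn.
  apply: leq_add; last by apply: leq_sum => y _; exact: leq_subr.
  have := rhob x; lia.
have [x bx] : exists x, (b x < al x)%N.
  apply: contrapT => nx; have bE : b = al.
    apply: functional_extensionality_dep => x; apply/eqP; rewrite eqn_leq (proj1 bal) leqNgt.
    by apply/negP => bx; apply: nx; exists x.
  by move: bneg; rewrite bE /slope subr_lt0 ltz_nat ltnNge A.
have /gen_subrep_euler_ge0 := B b bal (ex_intro _ x bx).
have nE y : (n y - b y = (al y - b y) + ga y)%N.
  by have := aln y; have := proj1 bal y; rewrite /ga; lia.
under eq_bigr do rewrite nE mulnDr.
under [X in (_ <= X)%N -> _]eq_bigr do rewrite nE mulnDr.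
rewrite !big_split /= => le.
move: bneg; rewrite /slope; lia.
Qed.
End Stability.

(** * Power series and lifting *)

Section PowerSeries.
Variable F : fieldType.

Record powerseries := Powerseries { coefps : nat -> F }.

Implicit Types (f g h : powerseries) (p q : {poly F}).

Lemma powerseriesP f g : coefps f =1 coefps g -> f = g.
Proof. by case: f g => [f] [g] /= fg; congr Powerseries; apply/funext. Qed.

HB.instance Definition _ := gen_eqMixin powerseries.
HB.instance Definition _ := gen_choiceMixin powerseries.

(** Associativity and commutativity of the product are inherited from polynomials, as each
    coefficient of a product depends only on truncations of the factors. *)
Definition ps_trunc n f : {poly F} := \poly_(i < n.+1) coefps f i.
Definition ps_zero := Powerseries (fun=> 0).
Definition ps_one := Powerseries (fun n => (n == 0%N)%:R).
Definition ps_opp f := Powerseries (fun n => - coefps f n).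
Definition ps_add f g := Powerseries (fun n => coefps f n + coefps g n).
Definition ps_mul f g := Powerseries (fun n => \sum_(i < n.+1) coefps f i * coefps g (n - i)%N).

Fact ps_addA : associative ps_add.
Proof. by move=> f g h; apply: powerseriesP => n /=; rewrite addrA. Qed.
Fact ps_addC : commutative ps_add.
Proof. by move=> f g; apply: powerseriesP => n /=; rewrite addrC. Qed.
Fact ps_add0 : left_id ps_zero ps_add.
Proof. by move=> f; apply: powerseriesP => n /=; rewrite add0r. Qed.
Fact ps_addN : left_inverse ps_zero ps_opp ps_add.
Proof. by move=> f; apply: powerseriesP => n /=; rewrite addNr. Qed.

HB.instance Definition _ := GRing.isZmodule.Build powerseries ps_addA ps_addC ps_add0 ps_addN.

Lemma coef_trunc m n f : (n <= m)%N -> (ps_trunc m f)`_n = coefps f n.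
Proof. by move=> nm; rewrite coef_poly ltnS nm. Qed.

Lemma coef_trunc_mul m n f g : (n <= m)%N ->
  (ps_trunc m f * ps_trunc m g)`_n = coefps (ps_mul f g) n.
Proof.
move=> nm; rewrite coefM; apply: eq_bigr => i _.
have im : (i <= n)%N by rewrite -ltnS.
by rewrite !coef_trunc // ?(leq_trans _ nm) // leq_subr.
Qed.

Lemma coefM_low m n p p' q q' : (n <= m)%N ->
  (forall i, (i <= m)%N -> p`_i = p'`_i) -> (forall i, (i <= m)%N -> q`_i = q'`_i) ->
  (p * q)`_n = (p' * q')`_n.
Proof.
move=> nm pp qq; rewrite !coefM; apply: eq_bigr => i _.
have im : (i <= n)%N by rewrite -ltnS.
by rewrite pp ?qq // (leq_trans _ nm) // leq_subr.
Qed.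

Fact ps_mulA : associative ps_mul.
Proof.
move=> f g h; apply: powerseriesP => n.
rewrite -!(@coef_trunc_mul n) //.
transitivity (ps_trunc n f * (ps_trunc n g * ps_trunc n h))`_n.
  by apply: (@coefM_low n) => // i im; rewrite coef_trunc // coef_trunc_mul.
rewrite mulrA; apply: (@coefM_low n) => // i im.
by rewrite coef_trunc // coef_trunc_mul.
Qed.
Fact ps_mulC : commutative ps_mul.
Proof.
move=> f g; apply: powerseriesP => n.
by rewrite -!(@coef_trunc_mul n) // mulrC.
Qed.
Fact ps_mul1 : left_id ps_one ps_mul.
Proof.
move=> f; apply: powerseriesP => n /=; rewrite big_ord_recl /= mul1r subn0 big1 ?addr0 //.
by move=> i _; rewrite mul0r.
Qed.
Fact ps_mulDl : left_distributive ps_mul ps_add.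
Proof.
move=> f g h; apply: powerseriesP => n /=; rewrite -big_split.
by apply: eq_bigr => i _; rewrite mulrDl.
Qed.
Fact ps_one_neq0 : ps_one != ps_zero.
Proof.
by apply/eqP => /(congr1 (fun f => coefps f 0)) /eqP; rewrite oner_eq0.
Qed.

HB.instance Definition _ := GRing.Zmodule_isComNzRing.Build powerseries
  ps_mulA ps_mulC ps_mul1 ps_mulDl ps_one_neq0.

Lemma coefpsD f g n : coefps (f + g) n = coefps f n + coefps g n.
Proof. by []. Qed.

Lemma coefps_sum (I : Type) (r : seq I) (f : I -> powerseries) n :
  coefps (\sum_(i <- r) f i) n = \sum_(i <- r) coefps (f i) n.
Proof.
by elim: r => [|i r IH]; rewrite ?big_nil // !big_cons coefpsD IH.
Qed.

Lemma coefpsM f g n : coefps (f * g) n = \sum_(i < n.+1) coefps f i * coefps g (n - i)%N.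
Proof. by []. Qed.

Definition ps_unit f := `[< exists g, g * f = 1 >].
Definition ps_inv f := if pselect (exists g, g * f = 1) is left ex then sval (cid ex) else f.

Fact ps_mulV : {in ps_unit, left_inverse 1 ps_inv *%R}.
Proof.
by move=> f /asboolP fu; rewrite /ps_inv; case: pselect => // ex; case: cid.
Qed.
Fact ps_unitP f g : g * f = 1 -> ps_unit f.
Proof. by move=> gf; apply/asboolP; exists g. Qed.
Fact ps_inv_out : {in [predC ps_unit], ps_inv =1 id}.
Proof.
by move=> f /asboolP fu; rewrite /ps_inv; case: pselect.
Qed.

HB.instance Definition _ := GRing.ComNzRing_hasMulInverse.Build powerseries
  ps_mulV ps_unitP ps_inv_out.

Fact ps_mul_eq0 f g : f * g = 0 -> (f == 0) || (g == 0).
Proof.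
move=> fg; apply: contrapT => /negP; rewrite negb_or => /andP[f0 g0].
have low h : h != 0 -> exists2 m, coefps h m != 0 & forall i, (i < m)%N -> coefps h i = 0.
  move=> h0; have [|m hm mmin] := @ex_minnP (fun m => coefps h m != 0).
    apply: contrapT => hn; case/eqP: h0; apply: powerseriesP => m; apply/eqP.
    by apply: contrapT => /negP hm; apply: hn; exists m.
  exists m => // i im; apply/eqP; apply: contraLR im => hi; rewrite -leqNgt.
  exact: mmin.
have [m fm flow] := low f f0; have [n gn glow] := low g g0.
have mmn : (m < (m + n).+1)%N by rewrite ltnS leq_addr.
have := congr1 (fun h => coefps h (m + n)) fg.
rewrite coefpsM (bigD1 (Ordinal mmn)) //= addKn big1 ?addr0 => [/eqP|i im].
  by rewrite mulf_eq0 (negPf fm) (negPf gn).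
have [lt|ge] := ltnP i m; first by rewrite flow ?mul0r.
rewrite glow ?mulr0 //; move: im; rewrite -val_eqE /= => im.
by have := ltn_ord i; move: ge im; lia.
Qed.

HB.instance Definition _ := GRing.ComUnitRing_isIntegral.Build powerseries ps_mul_eq0.

Definition poly_ps p := Powerseries (fun n => p`_n).

Fact poly_ps_additive : {morph poly_ps : p q / p - q}.
Proof. by move=> p q; apply: powerseriesP => n; rewrite /= coefB. Qed.
Fact poly_ps_multiplicative : (poly_ps 1 = 1) * {morph poly_ps : p q / p * q}.
Proof.
split; first by apply: powerseriesP => n; rewrite /= coef1.
by move=> p q; apply: powerseriesP => n; rewrite /= coefM.
Qed.
HB.instance Definition _ := GRing.isZmodMorphism.Build _ _ poly_ps poly_ps_additive.
HB.instance Definition _ := GRing.isMonoidMorphism.Build _ _ poly_ps poly_ps_multiplicative.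

Lemma poly_ps_inj : injective poly_ps.
Proof.
move=> p q pq; apply/polyP => n.
exact: (congr1 (fun f => coefps f n) pq).
Qed.
End PowerSeries.

(** [G k] records the values up to index [k], all of which the next step may consult. *)
Lemma course_recursion (T : Type) (y0 : T) (step : nat -> (nat -> T) -> T) :
  (forall k Y Y', (forall i, (i <= k)%N -> Y i = Y' i) -> step k Y = step k Y') ->
  exists Y, Y 0%N = y0 /\ forall k, Y k.+1 = step k Y.
Proof.
move=> stepP.
pose G := fix G k : nat -> T := if k is k'.+1
  then fun j => if (j <= k')%N then G k' j else step k' (G k') else fun=> y0.
have GS k j : (j <= k)%N -> G k.+1 j = G k j by move=> jk /=; rewrite jk.
have GE k j : (j <= k)%N -> G k j = G j j.
  move=> jk; rewrite -(subnK jk); elim: (k - j)%N => [//|d IH].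
  by rewrite addSn GS ?leq_addl.
exists (fun k => G k k); split=> // k; rewrite /= ltnn; apply: stepP => i ik.
exact: GE.
Qed.

Section CoefMatrix.
Variable F : fieldType.
Local Notation PS := (powerseries F).

Definition coefmx k m n (M : 'M[PS]_(m, n)) : 'M[F]_(m, n) :=
  map_mx (fun f => coefps f k) M.

Definition ps_mx m n (A : 'M[{poly F}]_(m, n)) : 'M[PS]_(m, n) := map_mx (@poly_ps F) A.
Local Notation "A %:PS" := (ps_mx (map_mx polyC A)) (at level 2, left associativity).

Lemma coefmxP m n (M N : 'M[PS]_(m, n)) : (forall k, coefmx k M = coefmx k N) -> M = N.
Proof.
move=> MN; apply/matrixP => i j; apply: powerseriesP => k.
by have /matrixP/(_ i j) := MN k; rewrite !mxE.
Qed.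

Lemma coefmxD k m n (M N : 'M[PS]_(m, n)) : coefmx k (M + N) = coefmx k M + coefmx k N.
Proof. by apply/matrixP => i j; rewrite !mxE. Qed.

Lemma coefmxN k m n (M : 'M[PS]_(m, n)) : coefmx k (- M) = - coefmx k M.
Proof. by apply/matrixP => i j; rewrite !mxE. Qed.

Lemma coefmxM k m n p (M : 'M[PS]_(m, n)) (N : 'M[PS]_(n, p)) :
  coefmx k (M *m N) = \sum_(i < k.+1) coefmx i M *m coefmx (k - i) N.
Proof.
apply/matrixP => a b; rewrite !mxE coefps_sum summxE.
under [RHS]eq_bigr do rewrite mxE.
rewrite [RHS]exchange_big; apply: eq_bigr => c _; rewrite coefpsM.
by apply: eq_bigr => i _; rewrite !mxE.
Qed.

Lemma coefmxC k m n (A : 'M[F]_(m, n)) : coefmx k A%:PS = if k == 0%N then A else 0.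
Proof. by apply/matrixP => i j; rewrite !mxE /= coefC; case: ifP; rewrite ?mxE. Qed.

Lemma coefmxCM k m n p (A : 'M[F]_(m, n)) (N : 'M[PS]_(n, p)) :
  coefmx k (A%:PS *m N) = A *m coefmx k N.
Proof.
rewrite coefmxM big_ord_recl coefmxC subn0 big1 ?addr0 // => i _.
by rewrite coefmxC mul0mx.
Qed.

Lemma coefmxMC k m n p (N : 'M[PS]_(m, n)) (A : 'M[F]_(n, p)) :
  coefmx k (N *m A%:PS) = coefmx k N *m A.
Proof.
rewrite coefmxM big_ord_recr /= coefmxC subnn big1 ?add0r // => i _.
by rewrite coefmxC subn_eq0 leqNgt ltn_ord mulmx0.
Qed.

Lemma coefmxX k m n (M : 'M[PS]_(m, n)) :
  coefmx k (poly_ps 'X *: M) = if k is k'.+1 then coefmx k' M else 0.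
Proof.
apply/matrixP => i j; rewrite !mxE coefpsM; case: k => [|k].
  by rewrite big_ord1 /= coefX mul0r mxE.
rewrite !big_ord_recl /= !coefX mul0r add0r mul1r subSS subn0 big1 ?addr0 ?mxE // => l _.
by rewrite coefX mul0r.
Qed.
End CoefMatrix.

Section Lifting.
Variables (F : closedFieldType) (Q : quiver) (al ga : dimvec Q).
Variables (v0 : qrep F al) (w0 : qrep F ga).
Hypothesis ext0 : row_full (hom_diff_mx v0 w0).
Local Notation PS := (powerseries F).
Local Notation "A %:PS" := (ps_mx (map_mx polyC A)) (at level 2, left associativity).
Let n : dimvec Q := fun x => (al x + ga x)%N.

(* The graph of [Y] is a subrepresentation of [u0 + t (u - u0)] over the power series
   in [t], with [u0] the direct sum of [v0] and [w0]; [Y] is found coefficient by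
   coefficient, as [hom_diff v0 w0] is onto. *)
Lemma lift_subrep (A : forall a, 'M[F]_(al (source a), al (target a)))
    (B : forall a, 'M[F]_(al (source a), ga (target a)))
    (C : forall a, 'M[F]_(ga (source a), al (target a)))
    (D : forall a, 'M[F]_(ga (source a), ga (target a))) :
  exists Y : forall x, 'M[PS]_(al x, ga x), forall a,
    Y (source a) *m (w0 a)%:PS - (v0 a)%:PS *m Y (target a)
    + poly_ps 'X *: ((B a)%:PS + Y (source a) *m (D a)%:PS - (A a)%:PS *m Y (target a)
       - Y (source a) *m (C a)%:PS *m Y (target a)) = 0.
Proof.
have [sol solP] := choice (hom_diff_mxP _ _ ext0).
(* [rhs k] is the coefficient of degree [k] in the bracket. The factor ['X] shifts it, so it
   determines the coefficient of degree [k.+1] of [Y]; that of degree 0 is 0, the graph being the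
   summand [v0] at [t = 0]. *)
pose rhs k (Y : nat -> forall x, 'M[F]_(al x, ga x)) a : 'M[F]_(al (source a), ga (target a)) :=
  (if k == 0%N then B a else 0) + Y k (source a) *m D a - A a *m Y k (target a)
  - \sum_(i < k.+1) Y i (source a) *m C a *m Y (k - i)%N (target a).
have [|Y [Y0 YS]] := @course_recursion (forall x, 'M[F]_(al x, ga x)) (fun=> 0)
  (fun k Y => sol (fun a => - rhs k Y a)).
  move=> k Y Y' YY'; congr sol; apply: functional_extensionality_dep => a.
  rewrite /rhs !YY' //; congr (- (_ - _)); apply: eq_bigr => i _.
  by rewrite !YY' ?leq_subr // -ltnS.
pose Yh x : 'M[PS]_(al x, ga x) := \matrix_(i, j) Powerseries (fun k => Y k x i j).
exists Yh => a.
have cY k x : coefmx k (Yh x) = Y k x by apply/matrixP => i j; rewrite !mxE.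
apply: coefmxP => k.
have -> : coefmx k (0 : 'M[PS]_(al (source a), ga (target a))) = 0.
  by apply/matrixP => i j; rewrite !mxE.
rewrite !coefmxD coefmxN coefmxMC coefmxCM !cY coefmxX.
case: k => [|k]; first by rewrite Y0 mul0mx mulmx0 subrr addr0.
have := solP (fun a => - rhs k Y a) a; rewrite -YS /hom_diff => ->.
have comb (M1 M2 M3 M4 : 'M[PS]_(al (source a), ga (target a))) :
    coefmx k (M1 + M2 - M3 - M4) = coefmx k M1 + coefmx k M2 - coefmx k M3 - coefmx k M4.
  by apply/matrixP => i j; rewrite !mxE.
have cD : coefmx k (Yh (source a) *m (D a)%:PS) = Y k (source a) *m D a.
  by rewrite coefmxMC cY.
have cA : coefmx k ((A a)%:PS *m Yh (target a)) = A a *m Y k (target a).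
  by rewrite coefmxCM cY.
have cC : coefmx k (Yh (source a) *m (C a)%:PS *m Yh (target a)) =
    \sum_(i < k.+1) Y i (source a) *m C a *m Y (k - i)%N (target a).
  by rewrite coefmxM; apply: eq_bigr => i _; rewrite coefmxMC !cY.
rewrite comb (coefmxC k (B a)) cD cA cC.
by rewrite addNr.
Qed.

(** The formal lift need not converge at [t = 1], where the line reaches [u]. But the line itself
    has polynomial entries, and evaluation of polynomials at 1 extends to a place of the fraction
    field of power series, which specializes whatever subrepresentation exists there. *)
Lemma has_subrep_of_ext0 (u : qrep F n) : has_subrep u al.
Proof.
pose ul a := ulsubmx (u a : 'M_(al (source a) + ga (source a), al (target a) + ga (target a))).
pose ur a := ursubmx (u a : 'M_(al (source a) + ga (source a), al (target a) + ga (target a))).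
pose dl a := dlsubmx (u a : 'M_(al (source a) + ga (source a), al (target a) + ga (target a))).
pose dr a := drsubmx (u a : 'M_(al (source a) + ga (source a), al (target a) + ga (target a))).
have [Y YE] := lift_subrep (fun a => ul a - v0 a) ur dl (fun a => dr a - w0 a).
pose P a : 'M[{poly F}]_(n (source a), n (target a)) :=
  block_mx (map_mx polyC (v0 a) + 'X *: map_mx polyC (ul a - v0 a)) ('X *: map_mx polyC (ur a))
    ('X *: map_mx polyC (dl a)) (map_mx polyC (w0 a) + 'X *: map_mx polyC (dr a - w0 a)).
pose toK : {poly F} -> {fraction PS} := fun p => tofrac (poly_ps p).
pose G := [set (toK p, p.[1]) | p in [set: {poly F}]]%classic.
have GP : ring_graph G.
  split.
  - by exists 1; rewrite // /toK !rmorph1 hornerC.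
  - by move=> _ _ [p _ <-] [q _ <-]; exists (p - q); rewrite // /toK !rmorphB !hornerE.
  - by move=> _ _ [p _ <-] [q _ <-]; exists (p * q); rewrite // /toK !rmorphM !hornerE.
  - move=> y [p _ [/eqP]]; rewrite /toK tofrac_eq0 -(rmorph0 (@poly_ps F)).
    by rewrite (inj_eq (@poly_ps_inj F)) => /eqP -> <-; rewrite horner0.
have P1 a : map_mx (horner_eval 1) (P a) = u a.
  have evX m k (M : 'M[F]_(m, k)) : map_mx (horner_eval 1) ('X *: map_mx polyC M) = M.
    by apply/matrixP => i j; rewrite !mxE /horner_eval hornerM hornerX hornerC mul1r.
  have evD m k (M N : 'M[F]_(m, k)) :
      map_mx (horner_eval 1) (map_mx polyC M + 'X *: map_mx polyC (N - M)) = N.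
    apply/matrixP => i j; rewrite !mxE /horner_eval hornerD hornerM hornerX !hornerC.
    ring.
  by rewrite map_block_mx !evX !evD submxK.
apply: (@has_subrep_specialize _ _ G Q n al (fun a => map_mx (@tofrac PS) (ps_mx (P a))) u GP).
  by move=> a i j; exists (P a i j); rewrite // -P1 !mxE.
pose S x : 'M[PS]_(al x, n x) := row_mx 1%:M (Y x).
pose A a := ps_mx (map_mx polyC (v0 a) + 'X *: map_mx polyC (ul a - v0 a)).
pose C a := ps_mx ('X *: map_mx polyC (dl a)).
exists (fun x => map_mx (@tofrac PS) (S x)); split.
  move=> x; apply/row_freeP; exists (map_mx (@tofrac PS) (col_mx 1%:M 0)).
  by rewrite -map_mxM mul_row_col mulmx1 mulmx0 addr0 map_mx1.
exists (fun a => map_mx (@tofrac PS) (A a + Y (source a) *m C a)) => a.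
rewrite -!map_mxM; congr map_mx.
rewrite /S /P /ps_mx map_block_mx mul_row_block mul_mx_row mulmx1 !mul1mx.
(* The left blocks agree by the choice of the induced representation; equality of the right blocks
   is the equation solved by [lift_subrep]. *)
congr row_mx.
apply/eqP; rewrite -subr_eq0; apply/eqP; rewrite -[RHS](YE a).
have psD m k (M N : 'M[{poly F}]_(m, k)) : ps_mx (M + N) = ps_mx M + ps_mx N by exact: map_mxD.
have psX m k (M : 'M[{poly F}]_(m, k)) : ps_mx ('X *: M) = poly_ps 'X *: ps_mx M.
  by apply/matrixP => i j; rewrite !mxE rmorphM.
rewrite -!/(ps_mx _) /A /C !psD !psX.
rewrite !mulmxDr !mulmxDl -!scalemxAr -!scalemxAl.
set y0 := (ur a)%:PS; set y1 := Y _ *m (w0 a)%:PS; set y2 := (v0 a)%:PS *m _.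
set y3 := Y _ *m (dr a - w0 a)%:PS; set y4 := (ul a - v0 a)%:PS *m _.
set y5 := Y _ *m (dl a)%:PS *m _.
move: y0 y1 y2 y3 y4 y5 => y0 y1 y2 y3 y4 y5.
by apply/matrixP => i j; rewrite !mxE; ring.
Qed.
End Lifting.

(** * Coordinates *)

Import passmx.

Section VectorSpaces.
Variables (F : fieldType) (Q : quiver).

Lemma mxrank_msof (vT : vectType F) (e : (\dim {:vT}).-tuple vT) (V : {vspace vT}) :
  basis_of {:vT} e -> \rank (msof e V) = \dim V.
Proof.
move=> e_basis; pose X := vbasis V.
pose N : 'M[F]_(\dim V, \dim {:vT}) := \matrix_i rVof e X`_i.
have mulN (c : 'rV_(\dim V)) : c *m N = rVof e (\sum_i c 0 i *: X`_i).
  by rewrite mulmx_sum_row linear_sum; apply: eq_bigr => i _; rewrite rowK linearZ.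
have /eqP <- : row_free N.
  apply: inj_row_free => c; rewrite mulN => /eqP; rewrite rVof_eq0 // => /eqP cX.
  apply/rowP => i; rewrite mxE.
  by have /freeP := basis_free (vbasisP V); apply; exact: cX.
apply/eqmx_rank/andP; split; last first.
  apply/row_subP => i; rewrite rowK -mem_vecof // rVofK //.
  by apply: vbasis_mem; rewrite mem_nth // size_tuple.
apply/rV_subP => u; rewrite -mem_vecof // => uV; apply/submxP.
exists (\row_i coord X i (vecof e u)); rewrite mulN -[LHS](vecofK e_basis); congr rVof.
by rewrite [LHS](coord_vbasis uV); apply: eq_bigr => i _; rewrite mxE.
Qed.

Lemma subrepresentation_coords (V : vertex Q -> vectType F) (b : dimvec Q) :
  (forall v : representation V, exists S : forall x, {vspace V x},
     subrepresentation v S /\ forall x, \dim (S x) = b x) <->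
  forall v : qrep F (fun x => \dim {:V x}), has_subrep v b.
Proof.
pose e x := vbasis {:V x}; have eP x : basis_of {:V x} (e x) by exact: vbasisP.
split=> gen v.
  have [S [Sv Sb]] := gen (fun a => hommx (e (source a)) (e (target a)) (v a)).
  apply: (@has_subrep_spaces _ _ _ v _ b (fun x => msof (e x) (S x))) => [a|x].
    apply/rV_subP => _ /submxP[z ->]; rewrite -mem_vecof // mulmxA (vecof_mul (eP (source a))) //.
    by apply: (subvP (Sv a)); apply: memv_img; rewrite mem_vecof // submxMl.
  by rewrite mxrank_msof.
have [S [Sfree [X SX]]] := gen (fun a => mxof (e (source a)) (e (target a)) (v a)).
exists (fun x => vsof (e x) <<S x>>%MS); split=> [a|x].
  apply/subvP => _ /memv_imgP[u uS ->]; move: uS; rewrite -!rVof_sub // (rVof_app _ (eP (source a))) //.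
  rewrite !genmxE => /submxP[z ->]; rewrite -mulmxA SX mulmxA; exact: submxMl.
rewrite -(mxrank_msof _ (eP x)) (eqmxP (vsofK (eP x) _)) genmxE.
exact/eqP/Sfree.
Qed.

Lemma schofield_leP (b n : dimvec Q) : schofield_le F b n <-> gen_subrep F b n.
Proof.
split=> -[bn gen]; split=> //.
  pose V x : vectType F := 'rV[F]_(n x).
  have Vn x : \dim {:V x} = n x by rewrite dimvf /dim /= mul1n.
  have <- : (fun x => \dim {:V x}) = n by exact: functional_extensionality_dep.
  exact/subrepresentation_coords/gen.
move=> V Vn; apply/subrepresentation_coords.
by have -> : (fun x => \dim {:V x}) = n by exact: functional_extensionality_dep.
Qed.
End VectorSpaces.

Lemma uncountable_complex (R : realType) : ~ countable [set: R[i]].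
Proof.
move=> cC; apply: (@uncountable_real R).
suff -> : [set: R]%classic = ((@complex.Re R) @` [set: R[i]])%classic by exact: countable_image.
by apply/seteqP; split=> // x _; exists (x%:C)%C.
Qed.

Theorem theorem1p3 (R : realType) (Q : quiver) (alpha n : dimvec Q)
    (le_alpha_n : dimvec_le alpha n) :
  schofield_le R[i] alpha n <->
  0 <= euler_form (fun x => (alpha x)%:Z) (fun x => (n x)%:Z - (alpha x)%:Z)
  /\ (forall beta : dimvec Q,
        schofield_lt R[i] beta alpha -> schofield_lt R[i] beta n).
Proof.
have eulerE : (0 <= euler_form (fun x => (alpha x)%:Z) (fun x => (n x)%:Z - (alpha x)%:Z)) =
    (\sum_a alpha (source a) * (n (target a) - alpha (target a)) <=
     \sum_x alpha x * (n x - alpha x))%N.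
  rewrite /euler_form subr_ge0 -lez_nat !(big_morph Posz PoszD (erefl _)).
  by congr (_ <= _); apply: eq_bigr => i _; rewrite PoszM -subzn.
rewrite eulerE schofield_leP; split=> [gen|[A B]].
  split; first exact: (gen_subrep_euler_ge0 gen).
  move=> beta [/schofield_leP ba [x bx]]; split.
    by apply/schofield_leP; exact: gen_subrep_trans ba gen.
  by exists x; exact: leq_trans bx (le_alpha_n x).
have [|v [w vw]] := stable_ext0 (@uncountable_complex R) (@stable_of_gen_subrep _
  (@uncountable_complex R) _ _ _ le_alpha_n A _).
  by move=> b /schofield_leP ba bx; apply/schofield_leP; case: (B b).
split=> // u.
have nE : n = (fun x => alpha x + (n x - alpha x))%N.
  by apply: functional_extensionality_dep => x; rewrite subnKC.
move: u; rewrite nE => u; exact: (has_subrep_of_ext0 vw).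
Qed.
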